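(* Let $R$ be a cocommutative Hopf $k$-algebra. Choose the following: - a character $\chi$ of $R$; - $z,y_+,y_-\in G(R)\cap Z(R)$ with $z=y_+y_-$ and $\xi := \chi(y_+)=\chi(y_-)$; - an element $h\in Z(R)$ with either (i) $h\in k(z-1)$, or (ii) $h\in P(R)$; when (ii) holds, it is also required that $z=1$, so that $y_-=y_+^{-1}$ and $\xi\in\{\pm1\}$. Set $\sigma := \tau^l_{\chi}$. Then the ambiskew algebra $A := A(R,\widehat{X}_+,\widehat{X}_-,\sigma,h,\xi)$ has a Hopf structure extending that of $R$, with $$\Delta(\widehat{X}_{\pm}) = \widehat{X}_{\pm}\otimes 1+y_{\pm}\otimes\widehat{X}_{\pm}.$$ Conversely, every ambiskew algebra $A(R,X_+,X_-,\sigma,h,\xi)$ with a Hopf algebra structure extending that of $R$ and satisfying $\Delta(X_{\pm})=X_{\pm}\otimes r_{\pm}+l_{\pm}\otimes X_{\pm}$ for some $l_{\pm},r_{\pm}\in R$ arises in this way, after a change of ambiskew variables $\widehat{X}_{\pm}=X_{\pm}r_{\pm}^{-1}$ (with corresponding adjustment of $\sigma,h,\xi$).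
   Context: $k$ is an arbitrary field; Hopf algebras have bijective antipode. Given a $k$-algebra $R$, a $k$-algebra automorphism $\sigma$ of $R$, a central element $h\in R$, and a nonzero $\xi\in k$, the ambiskew algebra $A(R,X_+,X_-,\sigma,h,\xi)$ is the $k$-algebra generated by $R$ and $X_+,X_-$ subject to $X_+r=\sigma(r)X_+$, $X_-r=\sigma^{-1}(r)X_-$ ($r\in R$), $X_+X_-=h+\xi X_-X_+$. $G(R)$ is the group of grouplike elements, $Z(R)$ the centre, $P(R)=\{a:\Delta(a)=a\otimes1+1\otimes a\}$ the space of primitive elements. A character of $R$ is a $k$-algebra homomorphism $\chi:R\to k$, and $\tau^l_{\chi}(a)=\sum\chi(a_1)a_2$ where $\Delta(a)=\sum a_1\otimes a_2$. *)

(* Defs.v *)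
(* Mathematical Components, with the classical axioms of mathcomp-classical. *)
From HB Require Import structures.
From mathcomp Require Import all_boot all_algebra.
From mathcomp Require Import boolp.

Set Implicit Arguments.
Unset Strict Implicit.
Unset Printing Implicit Defensive.

Import GRing.Theory.
Local Open Scope ring_scope.
Local Open Scope quotient_scope.

(** * Tensor product of vector spaces

    [tensor U V] is the quotient of the formal sums of pairs by the relations
    defining U (x) V; the list [:: (u1, v1); ...; (un, vn)] stands for
    u1 (x) v1 + ... + un (x) vn. *)

Section Tensor.
Variables (k : fieldType) (U V : lmodType k).

Inductive tensor_eq : seq (U * V) -> seq (U * V) -> Prop :=
| tensor_eq_refl s : tensor_eq s s
| tensor_eq_sym s t : tensor_eq s t -> tensor_eq t s
| tensor_eq_trans s t r : tensor_eq s t -> tensor_eq t r -> tensor_eq s r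
| tensor_eq_cat s s' t t' :
    tensor_eq s s' -> tensor_eq t t' -> tensor_eq (s ++ t) (s' ++ t')
| tensor_eq_catC s t : tensor_eq (s ++ t) (t ++ s)
| tensor_eq0 v : tensor_eq [:: (0, v)] [::]
| tensor_eqDl u u' v : tensor_eq [:: (u + u', v)] [:: (u, v); (u', v)]
| tensor_eqDr u v v' : tensor_eq [:: (u, v + v')] [:: (u, v); (u, v')]
| tensor_eqZ c u v : tensor_eq [:: (c *: u, v)] [:: (u, c *: v)].

Definition tensor_rel : rel (seq (U * V)) := fun s t => `[< tensor_eq s t >].

Lemma tensor_rel_refl : reflexive tensor_rel.
Proof. by move=> s; apply/asboolP/tensor_eq_refl. Qed.

Lemma tensor_rel_sym : symmetric tensor_rel.
Proof. by move=> s t; apply/asboolP/asboolP; apply: tensor_eq_sym. Qed.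

Lemma tensor_rel_trans : transitive tensor_rel.
Proof.
by move=> s r t /asboolP h1 /asboolP h2; apply/asboolP/(tensor_eq_trans h1 h2).
Qed.

Canonical tensor_equiv :=
  EquivRel tensor_rel tensor_rel_refl tensor_rel_sym tensor_rel_trans.

Definition tensor := {eq_quot tensor_rel}.

HB.instance Definition _ := Choice.on tensor.

Definition tensor_of (s : seq (U * V)) : tensor := \pi_{eq_quot tensor_rel} s.

Definition tens (u : U) (v : V) : tensor := tensor_of [:: (u, v)].

Definition tensor_repr (t : tensor) : seq (U * V) :=
  repr (t : {eq_quot tensor_rel}).

Lemma tensor_reprK t : tensor_of (tensor_repr t) = t.
Proof. exact: reprK. Qed.

Lemma tensor_ofP s t : tensor_of s = tensor_of t <-> tensor_eq s t.
Proof.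
split=> h; first by apply/asboolP/(@eqmodP _ tensor_equiv).
exact/(@eqmodP _ tensor_equiv)/asboolP.
Qed.

Lemma tensor_repr_of s : tensor_eq (tensor_repr (tensor_of s)) s.
Proof. by apply/tensor_ofP; rewrite tensor_reprK. Qed.

(* [tsum f t] is Sweedler's "sum of f u v for t = sum of u (x) v". It is
   independent of the chosen representative, and meaningful, when f is
   bilinear: it is then the linear map induced by f. *)
Definition tsum (W : nmodType) (f : U -> V -> W) (t : tensor) : W :=
  \sum_(p <- tensor_repr t) f p.1 p.2.

Definition bilin (W : lmodType k) (f : U -> V -> W) : Prop :=
  (forall v, linear (f^~ v)) /\ (forall u, linear (f u)).

Lemma tsum_of (W : lmodType k) (f : U -> V -> W) s :
  bilin f -> tsum f (tensor_of s) = \sum_(p <- s) f p.1 p.2.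
Proof.
case=> fl fr.
have fDl u u' v : f (u + u') v = f u v + f u' v.
  by have := fl v 1 u u'; rewrite !scale1r.
have fDr u v v' : f u (v + v') = f u v + f u v'.
  by have := fr u 1 v v'; rewrite !scale1r.
have f0l v : f 0 v = 0.
  by apply: (addIr (f 0 v)); rewrite -fDl !add0r.
have f0r u : f u 0 = 0.
  by apply: (addIr (f u 0)); rewrite -fDr !add0r.
have fZl c u v : f (c *: u) v = c *: f u v.
  by have := fl v c u 0; rewrite f0l !addr0.
have fZr c u v : f u (c *: v) = c *: f u v.
  by have := fr u c v 0; rewrite f0r !addr0.
suff H s1 s2 : tensor_eq s1 s2 ->
    \sum_(p <- s1) f p.1 p.2 = \sum_(p <- s2) f p.1 p.2.
  exact/H/tensor_repr_of.
elim=> {s s1 s2} //=.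
- by move=> s t r _ -> _ ->.
- by move=> s s' t t' _ h1 _ h2; rewrite !big_cat /= h1 h2.
- by move=> s t; rewrite !big_cat /= addrC.
- by move=> v; rewrite big_seq1 big_nil /= f0l.
- by move=> u u' v; rewrite big_seq1 big_cons big_seq1 /= fDl.
- by move=> u v v'; rewrite big_seq1 big_cons big_seq1 /= fDr.
- by move=> c u v; rewrite !big_seq1 /= fZl fZr.
Qed.

Lemma tensor_eq0r u : tensor_eq [:: (u, 0)] [::].
Proof.
apply: tensor_eq_trans (tensor_eq0 0).
by have := tensor_eqZ 0 u 0; rewrite !scale0r => /tensor_eq_sym.
Qed.

Definition tadd (x y : tensor) : tensor :=
  tensor_of (tensor_repr x ++ tensor_repr y).

Definition tscale (c : k) (x : tensor) : tensor :=
  tensor_of [seq (c *: p.1, p.2) | p <- tensor_repr x].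

Lemma tadd_of s t : tadd (tensor_of s) (tensor_of t) = tensor_of (s ++ t).
Proof. by apply/tensor_ofP/tensor_eq_cat; apply: tensor_repr_of. Qed.

Lemma tscale_of c s :
  tscale c (tensor_of s) = tensor_of [seq (c *: p.1, p.2) | p <- s].
Proof.
apply/tensor_ofP; have := tensor_repr_of s.
move: (tensor_repr _) => r; elim=> {r s} //= *;
  rewrite ?map_cat ?scaler0 ?scalerDr ?scalerA.
- exact: tensor_eq_refl.
- exact: tensor_eq_sym.
- by apply: tensor_eq_trans; eassumption.
- exact: tensor_eq_cat.
- exact: tensor_eq_catC.
- exact: tensor_eq0.
- exact: tensor_eqDl.
- exact: tensor_eqDr.
- by rewrite mulrC -scalerA; apply: tensor_eqZ.
Qed.

Lemma tensorW (P : tensor -> Prop) :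
  (forall s, P (tensor_of s)) -> forall x, P x.
Proof. by move=> h x; rewrite -(tensor_reprK x). Qed.

Lemma taddA : associative tadd.
Proof.
elim/tensorW=> s; elim/tensorW=> t; elim/tensorW=> r.
by rewrite !tadd_of catA.
Qed.

Lemma taddC : commutative tadd.
Proof.
elim/tensorW=> s; elim/tensorW=> t; rewrite !tadd_of.
exact/tensor_ofP/tensor_eq_catC.
Qed.

Lemma tadd0 : left_id (tensor_of [::]) tadd.
Proof. by elim/tensorW=> s; rewrite tadd_of. Qed.

Lemma taddN : left_inverse (tensor_of [::]) (tscale (-1)) tadd.
Proof.
elim/tensorW=> s; rewrite tscale_of tadd_of.
have tACA a b c d : tadd (tadd a b) (tadd c d) = tadd (tadd a c) (tadd b d).
  by rewrite !taddA; congr tadd; rewrite -!taddA (taddC b).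
elim: s => //= -[u v] s IH.
have -> : tensor_of
    ((-1 *: u, v) :: [seq (-1 *: p.1, p.2) | p <- s] ++ (u, v) :: s)
  = tadd (tadd (tensor_of [:: (-1 *: u, v)])
               (tensor_of [seq (-1 *: p.1, p.2) | p <- s]))
         (tadd (tensor_of [:: (u, v)]) (tensor_of s)).
  by rewrite !tadd_of.
rewrite tACA [X in tadd _ X]tadd_of IH !tadd_of cats0.
apply/tensor_ofP; apply: tensor_eq_trans (tensor_eq0 v).
by rewrite /= scaleN1r -(addNr u); apply/tensor_eq_sym/tensor_eqDl.
Qed.

HB.instance Definition _ := GRing.isZmodule.Build tensor
  taddA taddC tadd0 taddN.

Lemma tensor_of_cat s t : tensor_of (s ++ t) = tensor_of s + tensor_of t.
Proof. by rewrite -tadd_of. Qed.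

Lemma tensor_of_sum s : tensor_of s = \sum_(p <- s) tens p.1 p.2.
Proof.
elim: s => [|[u v] s IH]; first by rewrite big_nil.
by rewrite big_cons -IH -tensor_of_cat.
Qed.

Lemma tscaleA a b x : tscale a (tscale b x) = tscale (a * b) x.
Proof.
elim/tensorW: x => s; rewrite !tscale_of -map_comp; congr tensor_of.
by apply: eq_map => p /=; rewrite scalerA.
Qed.

Lemma tscale1 : left_id 1 tscale.
Proof.
elim/tensorW=> s; rewrite tscale_of; congr tensor_of.
by rewrite -[RHS]map_id; apply: eq_map => -[u v] /=; rewrite scale1r.
Qed.

Lemma tscaleDr : right_distributive tscale +%R.
Proof.
move=> c; elim/tensorW=> s; elim/tensorW=> t.
by rewrite -tensor_of_cat !tscale_of map_cat tensor_of_cat.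
Qed.

Lemma tscaleDl x : {morph tscale^~ x : a b / a + b}.
Proof.
elim/tensorW: x => s a b; rewrite !tscale_of.
rewrite !tensor_of_sum !big_map -big_split /=.
apply: eq_bigr => p _; rewrite scalerDl.
by rewrite -tensor_of_cat; apply/tensor_ofP/tensor_eqDl.
Qed.

HB.instance Definition _ :=
  GRing.Zmodule_isLmodule.Build k tensor tscaleA tscale1 tscaleDr tscaleDl.

Lemma tens_bilin : bilin tens.
Proof.
split=> [v c u u'|u c v v'].
- rewrite /tens [c *: tensor_of _]tscale_of -tensor_of_cat /=.
  exact/tensor_ofP/tensor_eqDl.
- rewrite /tens [c *: tensor_of _]tscale_of -tensor_of_cat /=; apply/tensor_ofP.
  apply: tensor_eq_trans (tensor_eqDr _ _ _) _.
  rewrite -[X in tensor_eq X]cat1s -[X in tensor_eq _ X]cat1s.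
  apply: tensor_eq_cat (tensor_eq_refl _).
  exact/tensor_eq_sym/tensor_eqZ.
Qed.

Lemma tsumE (W : lmodType k) (f : U -> V -> W) u v :
  bilin f -> tsum f (tens u v) = f u v.
Proof. by move=> fb; rewrite tsum_of // big_seq1. Qed.

Lemma tsum_linear (W : lmodType k) (f : U -> V -> W) :
  bilin f -> linear (tsum f).
Proof.
move=> fb c; elim/tensorW=> s; elim/tensorW=> t.
rewrite [c *: tensor_of _]tscale_of -tensor_of_cat !tsum_of // big_cat big_map /=.
congr (_ + _); rewrite scaler_sumr; apply: eq_bigr => p _ /=.
have f0 : f 0 p.2 = 0.
  by have := fb.1 p.2 (-1) 0 0; rewrite scaleN1r oppr0 addr0 scaleN1r addNr.
by have := fb.1 p.2 c p.1 0; rewrite !addr0 f0 addr0.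
Qed.

Lemma tensor_ind (P : tensor -> Prop) :
  (forall u v, P (tens u v)) -> P 0 ->
  (forall x y, P x -> P y -> P (x + y)) -> forall x, P x.
Proof.
move=> Pt P0 PD; elim/tensorW=> s; rewrite tensor_of_sum.
by apply: (big_ind P).
Qed.

End Tensor.

(** * The tensor product of two algebras *)

Section TensorAlgebra.
Variables (k : fieldType) (A B : algType k).
Implicit Types x y : tensor A B.

Definition tmul x y : tensor A B :=
  tsum (fun a b => tsum (fun a' b' => tens (a * a') (b * b')) y) x.

Definition tone : tensor A B := tens 1 1.

Lemma tmul_bilin_r a b :
  bilin (fun a' b' => tens (a * a') (b * b') : tensor A B).
Proof.
split=> [v c u u'|u c v v'].
- by rewrite mulrDr -scalerAr; apply: (tens_bilin A B).1.
- by rewrite mulrDr -scalerAr; apply: (tens_bilin A B).2.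
Qed.

Lemma tmul_bilin_l y :
  bilin (fun a b => tsum (fun a' b' => tens (a * a') (b * b')) y : tensor A B).
Proof.
split=> [b c a a'|a c b b'].
- rewrite /tsum scaler_sumr -big_split /=; apply: eq_bigr => p _.
  by rewrite mulrDl -scalerAl; apply: (tens_bilin A B).1.
- rewrite /tsum scaler_sumr -big_split /=; apply: eq_bigr => p _.
  by rewrite mulrDl -scalerAl; apply: (tens_bilin A B).2.
Qed.

Lemma tmul_linear_l y : linear (tmul^~ y).
Proof. exact: (tsum_linear (tmul_bilin_l y)). Qed.

Lemma tmul_linear_r x : linear (tmul x).
Proof.
move=> c y y'; rewrite /tmul /tsum scaler_sumr -big_split /=.
apply: eq_bigr => p _.
exact: (tsum_linear (tmul_bilin_r p.1 p.2)).
Qed.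

Lemma tmulDl : left_distributive tmul +%R.
Proof. by move=> x y z; have := tmul_linear_l z 1 x y; rewrite !scale1r. Qed.

Lemma tmulDr : right_distributive tmul +%R.
Proof. by move=> x y z; have := tmul_linear_r x 1 y z; rewrite !scale1r. Qed.

Lemma tmul0 y : tmul 0 y = 0.
Proof. by apply: (addIr (tmul 0 y)); rewrite -tmulDl !add0r. Qed.

Lemma tmulr0 x : tmul x 0 = 0.
Proof. by apply: (addIr (tmul x 0)); rewrite -tmulDr !add0r. Qed.

Lemma tmul_tens a b a' b' :
  tmul (tens a b) (tens a' b') = tens (a * a') (b * b').
Proof.
rewrite /tmul (tsumE _ _ (tmul_bilin_l _)).
by rewrite (tsumE _ _ (tmul_bilin_r _ _)).
Qed.

Lemma tmulA : associative tmul.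
Proof.
elim/tensor_ind=> [a b||x x' IH IH'] y z; last 2 first.
- by rewrite !tmul0.
- by rewrite !tmulDl IH IH'.
elim/tensor_ind: y => [a' b'||y y' IH IH']; last 2 first.
- by rewrite !(tmul0, tmulr0).
- by rewrite !(tmulDl, tmulDr) IH IH'.
elim/tensor_ind: z => [a'' b''||z z' IH IH']; last 2 first.
- by rewrite !tmulr0.
- by rewrite !tmulDr IH IH'.
by rewrite !tmul_tens !mulrA.
Qed.

Lemma tmul1 : left_id tone tmul.
Proof.
elim/tensor_ind=> [a b||x x' IH IH'].
- by rewrite tmul_tens !mul1r.
- by rewrite tmulr0.
- by rewrite tmulDr IH IH'.
Qed.

Lemma tmulr1 : right_id tone tmul.
Proof.
elim/tensor_ind=> [a b||x x' IH IH'].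
- by rewrite tmul_tens !mulr1.
- by rewrite tmul0.
- by rewrite tmulDl IH IH'.
Qed.

HB.instance Definition _ := GRing.Zmodule_isPzRing.Build (tensor A B)
  tmulA tmul1 tmulr1 tmulDl tmulDr.

Lemma tensM a b a' b' :
  (tens a b : tensor A B) * tens a' b' = tens (a * a') (b * b').
Proof. exact: tmul_tens. Qed.

End TensorAlgebra.

(* Algebras are nontrivial in the library. Nontriviality of A (x) B in general
   needs bases; for A (x) A, the only case used, the multiplication of A maps
   1 (x) 1 to 1. *)
Section TensorSquare.
Variables (k : fieldType) (A : algType k).

Lemma mul_bilin : bilin (fun a b : A => a * b).
Proof.
split=> [b c a a'|a c b b'].
- by rewrite mulrDl scalerAl.
- by rewrite mulrDr scalerAr.
Qed.

Lemma tensor_square1_neq0 : (1 : tensor A A) != 0.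
Proof.
apply/eqP => /(congr1 (tsum (fun a b : A => a * b))).
rewrite (tsumE _ _ mul_bilin) (tsum_of [::] mul_bilin) big_nil mulr1.
exact/eqP/oner_neq0.
Qed.

HB.instance Definition _ :=
  GRing.PzSemiRing_isNonZero.Build (tensor A A) tensor_square1_neq0.

Lemma tensor_scalerAl (c : k) (x y : tensor A A) : c *: (x * y) = (c *: x) * y.
Proof.
by have := tmul_linear_l y c x 0; rewrite tmul0 !addr0.
Qed.

HB.instance Definition _ :=
  GRing.Lmodule_isLalgebra.Build k (tensor A A) tensor_scalerAl.

Lemma tensor_scalerAr (c : k) (x y : tensor A A) : c *: (x * y) = x * (c *: y).
Proof.
by have := tmul_linear_r x c y 0; rewrite tmulr0 !addr0.
Qed.

HB.instance Definition _ :=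
  GRing.Lalgebra_isAlgebra.Build k (tensor A A) tensor_scalerAr.

End TensorSquare.

Section TensorMaps.
Variable k : fieldType.

Definition tmap (U V U' V' : lmodType k) (f : U -> U') (g : V -> V') :
    tensor U V -> tensor U' V' :=
  tsum (fun u v => tens (f u) (g v)).

Definition tassoc (U V W : lmodType k) :
    tensor (tensor U V) W -> tensor U (tensor V W) :=
  tsum (fun t w => tsum (fun u v => tens u (tens v w)) t).

Definition tswap (U V : lmodType k) : tensor U V -> tensor V U :=
  tsum (fun u v => tens v u).

End TensorMaps.

(** * Hopf algebras (with bijective antipode) *)

Record hopf (k : fieldType) (A : algType k) := Hopf {
  comul : {lrmorphism A -> tensor A A};
  counit : {lrmorphism A -> k^o};
  antipode : {linear A -> A};
  comulA : forall a,
    @tassoc k A A A (@tmap k A A (tensor A A) A comul id (comul a)) =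
    @tmap k A A A (tensor A A) id comul (comul a);
  counitl : forall a, @tsum k A A A (fun x y => (counit x : k) *: y) (comul a) = a;
  counitr : forall a, @tsum k A A A (fun x y => (counit y : k) *: x) (comul a) = a;
  antipodel : forall a,
    @tsum k A A A (fun x y => antipode x * y) (comul a) = (counit a : k)%:A;
  antipoder : forall a,
    @tsum k A A A (fun x y => x * antipode y) (comul a) = (counit a : k)%:A;
  antipode_bij : bijective antipode
}.

Section HopfNotions.
Variables (k : fieldType) (R : algType k) (H : hopf R).

Definition cocommutative : Prop :=
  forall a, @tswap k R R (comul H a) = comul H a.

Definition grouplike (g : R) : Prop := g != 0 /\ comul H g = tens g g.

Definition primitive (a : R) : Prop := comul H a = tens a 1 + tens 1 a.

Definition central (z : R) : Prop := forall r, z * r = r * z.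

(* tau^l_chi(a) = sum chi(a_1) a_2 *)
Definition tau_l (chi : {lrmorphism R -> k^o}) (a : R) : R :=
  @tsum k R R R (fun x y => (chi x : k) *: y) (comul H a).

Definition hopf_morphism (A : algType k) (HA : hopf A)
    (f : {lrmorphism R -> A}) : Prop :=
  [/\ forall a, comul HA (f a) = @tmap k R R A A f f (comul H a),
      forall a, counit HA (f a) = counit H a
    & forall a, antipode HA (f a) = f (antipode H a)].

End HopfNotions.

Definition two_sided_inverse (R : nzRingType) (x y : R) : Prop :=
  x * y = 1 /\ y * x = 1.

(** * Ambiskew algebras *)

Record ambiskew_data (k : fieldType) (R : algType k) := AmbiskewData {
  asigma : {lrmorphism R -> R};
  asigmaV : R -> R;
  asigmaK : cancel asigma asigmaV;
  asigmaVK : cancel asigmaV asigma;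
  ah : R;
  ah_central : central ah;
  axi : k;
  axi_neq0 : axi != 0
}.

Section Ambiskew.
Variables (k : fieldType) (R : algType k) (D : ambiskew_data R).

Inductive aterm :=
| AConst of R
| AXplus
| AXminus
| AAdd of aterm & aterm
| AMul of aterm & aterm
| AScale of k & aterm.

HB.instance Definition _ := gen_eqMixin aterm.
HB.instance Definition _ := gen_choiceMixin aterm.

(* The least congruence on terms imposing the axioms of a k-algebra, the
   operations of R on constants, and the three families of ambiskew relations;
   the quotient is the k-algebra generated by R, X+, X- with those relations. *)
Inductive aterm_eq : aterm -> aterm -> Prop :=
| ae_refl s : aterm_eq s s
| ae_sym s t : aterm_eq s t -> aterm_eq t s
| ae_trans s t u : aterm_eq s t -> aterm_eq t u -> aterm_eq s u
| ae_add s s' t t' :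
    aterm_eq s s' -> aterm_eq t t' -> aterm_eq (AAdd s t) (AAdd s' t')
| ae_mul s s' t t' :
    aterm_eq s s' -> aterm_eq t t' -> aterm_eq (AMul s t) (AMul s' t')
| ae_scale c s s' : aterm_eq s s' -> aterm_eq (AScale c s) (AScale c s')
| ae_addA s t u : aterm_eq (AAdd s (AAdd t u)) (AAdd (AAdd s t) u)
| ae_addC s t : aterm_eq (AAdd s t) (AAdd t s)
| ae_add0 s : aterm_eq (AAdd (AConst 0) s) s
| ae_addN s : aterm_eq (AAdd (AScale (-1) s) s) (AConst 0)
| ae_mulA s t u : aterm_eq (AMul s (AMul t u)) (AMul (AMul s t) u)
| ae_mul1l s : aterm_eq (AMul (AConst 1) s) s
| ae_mul1r s : aterm_eq (AMul s (AConst 1)) s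
| ae_mulDl s t u : aterm_eq (AMul (AAdd s t) u) (AAdd (AMul s u) (AMul t u))
| ae_mulDr s t u : aterm_eq (AMul s (AAdd t u)) (AAdd (AMul s t) (AMul s u))
| ae_scaleA a b s : aterm_eq (AScale a (AScale b s)) (AScale (a * b) s)
| ae_scale1 s : aterm_eq (AScale 1 s) s
| ae_scaleDr c s t :
    aterm_eq (AScale c (AAdd s t)) (AAdd (AScale c s) (AScale c t))
| ae_scaleDl a b s :
    aterm_eq (AScale (a + b) s) (AAdd (AScale a s) (AScale b s))
| ae_scaleAl c s t : aterm_eq (AScale c (AMul s t)) (AMul (AScale c s) t)
| ae_scaleAr c s t : aterm_eq (AScale c (AMul s t)) (AMul s (AScale c t))
| ae_constD r s : aterm_eq (AConst (r + s)) (AAdd (AConst r) (AConst s))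
| ae_constM r s : aterm_eq (AConst (r * s)) (AMul (AConst r) (AConst s))
| ae_constZ c r : aterm_eq (AConst (c *: r)) (AScale c (AConst r))
| ae_Xplus r :
    aterm_eq (AMul AXplus (AConst r)) (AMul (AConst (asigma D r)) AXplus)
| ae_Xminus r :
    aterm_eq (AMul AXminus (AConst r)) (AMul (AConst (asigmaV D r)) AXminus)
| ae_Xpm :
    aterm_eq (AMul AXplus AXminus)
      (AAdd (AConst (ah D)) (AScale (axi D) (AMul AXminus AXplus))).

Definition aterm_rel : rel aterm := fun s t => `[< aterm_eq s t >].

Lemma aterm_rel_refl : reflexive aterm_rel.
Proof. by move=> s; apply/asboolP/ae_refl. Qed.

Lemma aterm_rel_sym : symmetric aterm_rel.
Proof. by move=> s t; apply/asboolP/asboolP; apply: ae_sym. Qed.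

Lemma aterm_rel_trans : transitive aterm_rel.
Proof.
by move=> s r t /asboolP h1 /asboolP h2; apply/asboolP/(ae_trans h1 h2).
Qed.

Canonical aterm_equiv :=
  EquivRel aterm_rel aterm_rel_refl aterm_rel_sym aterm_rel_trans.

Definition ambiskew := {eq_quot aterm_rel}.

HB.instance Definition _ := Choice.on ambiskew.

Definition ambiskew_of (s : aterm) : ambiskew := \pi_{eq_quot aterm_rel} s.

Definition ambiskew_repr (x : ambiskew) : aterm :=
  repr (x : {eq_quot aterm_rel}).

Lemma ambiskew_reprK x : ambiskew_of (ambiskew_repr x) = x.
Proof. exact: reprK. Qed.

Lemma ambiskew_ofP s t : ambiskew_of s = ambiskew_of t <-> aterm_eq s t.
Proof.
split=> h; first by apply/asboolP/(@eqmodP _ aterm_equiv).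
exact/(@eqmodP _ aterm_equiv)/asboolP.
Qed.

Lemma ambiskew_repr_of s : aterm_eq (ambiskew_repr (ambiskew_of s)) s.
Proof. by apply/ambiskew_ofP; rewrite ambiskew_reprK. Qed.

Lemma ambiskewW (P : ambiskew -> Prop) :
  (forall s, P (ambiskew_of s)) -> forall x, P x.
Proof. by move=> h x; rewrite -(ambiskew_reprK x). Qed.

Definition ambiskew_add (x y : ambiskew) : ambiskew :=
  ambiskew_of (AAdd (ambiskew_repr x) (ambiskew_repr y)).
Definition ambiskew_mul (x y : ambiskew) : ambiskew :=
  ambiskew_of (AMul (ambiskew_repr x) (ambiskew_repr y)).
Definition ambiskew_scale (c : k) (x : ambiskew) : ambiskew :=
  ambiskew_of (AScale c (ambiskew_repr x)).

Lemma ambiskew_addE s t :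
  ambiskew_add (ambiskew_of s) (ambiskew_of t) = ambiskew_of (AAdd s t).
Proof. by apply/ambiskew_ofP/ae_add; apply: ambiskew_repr_of. Qed.

Lemma ambiskew_mulE s t :
  ambiskew_mul (ambiskew_of s) (ambiskew_of t) = ambiskew_of (AMul s t).
Proof. by apply/ambiskew_ofP/ae_mul; apply: ambiskew_repr_of. Qed.

Lemma ambiskew_scaleE c s :
  ambiskew_scale c (ambiskew_of s) = ambiskew_of (AScale c s).
Proof. by apply/ambiskew_ofP/ae_scale; apply: ambiskew_repr_of. Qed.

Lemma ambiskew_addA : associative ambiskew_add.
Proof.
elim/ambiskewW=> s; elim/ambiskewW=> t; elim/ambiskewW=> u.
by rewrite !ambiskew_addE; apply/ambiskew_ofP/ae_addA.
Qed.

Lemma ambiskew_addC : commutative ambiskew_add.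
Proof.
elim/ambiskewW=> s; elim/ambiskewW=> t.
by rewrite !ambiskew_addE; apply/ambiskew_ofP/ae_addC.
Qed.

Lemma ambiskew_add0 : left_id (ambiskew_of (AConst 0)) ambiskew_add.
Proof.
by elim/ambiskewW=> s; rewrite ambiskew_addE; apply/ambiskew_ofP/ae_add0.
Qed.

Lemma ambiskew_addN :
  left_inverse (ambiskew_of (AConst 0)) (ambiskew_scale (-1)) ambiskew_add.
Proof.
elim/ambiskewW=> s; rewrite ambiskew_scaleE ambiskew_addE.
exact/ambiskew_ofP/ae_addN.
Qed.

HB.instance Definition _ := GRing.isZmodule.Build ambiskew
  ambiskew_addA ambiskew_addC ambiskew_add0 ambiskew_addN.

Lemma ambiskew_mulA : associative ambiskew_mul.
Proof.
elim/ambiskewW=> s; elim/ambiskewW=> t; elim/ambiskewW=> u.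
by rewrite !ambiskew_mulE; apply/ambiskew_ofP/ae_mulA.
Qed.

Lemma ambiskew_mul1l : left_id (ambiskew_of (AConst 1)) ambiskew_mul.
Proof.
by elim/ambiskewW=> s; rewrite ambiskew_mulE; apply/ambiskew_ofP/ae_mul1l.
Qed.

Lemma ambiskew_mul1r : right_id (ambiskew_of (AConst 1)) ambiskew_mul.
Proof.
by elim/ambiskewW=> s; rewrite ambiskew_mulE; apply/ambiskew_ofP/ae_mul1r.
Qed.

Lemma ambiskew_mulDl : left_distributive ambiskew_mul ambiskew_add.
Proof.
elim/ambiskewW=> s; elim/ambiskewW=> t; elim/ambiskewW=> u.
by rewrite !(ambiskew_mulE, ambiskew_addE); apply/ambiskew_ofP/ae_mulDl.
Qed.

Lemma ambiskew_mulDr : right_distributive ambiskew_mul ambiskew_add.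
Proof.
elim/ambiskewW=> s; elim/ambiskewW=> t; elim/ambiskewW=> u.
by rewrite !(ambiskew_mulE, ambiskew_addE); apply/ambiskew_ofP/ae_mulDr.
Qed.

HB.instance Definition _ := GRing.Zmodule_isPzRing.Build ambiskew
  ambiskew_mulA ambiskew_mul1l ambiskew_mul1r ambiskew_mulDl ambiskew_mulDr.

(* The presented algebra acts on functions nat -> R as on the (completed)
   module A / A X+, with basis the powers of X-. Hence it is nonzero and
   contains R. *)
Fixpoint verma_coef (n : nat) : R :=
  if n is m.+1 then iter m (asigma D) (ah D) + axi D *: verma_coef m else 0.

Fixpoint verma (s : aterm) (f : nat -> R) : nat -> R :=
  match s with
  | AConst r => fun n => iter n (asigma D) r * f n
  | AXplus => fun n => verma_coef n.+1 * f n.+1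
  | AXminus => fun n => if n is m.+1 then f m else 0
  | AAdd s t => fun n => verma s f n + verma t f n
  | AMul s t => verma s (verma t f)
  | AScale c s => fun n => c *: verma s f n
  end.

Lemma iter_asigmaD n : {morph iter n (asigma D) : r s / r + s}.
Proof. by move=> r s; elim: n => //= n ->; rewrite rmorphD. Qed.

Lemma iter_asigmaM n : {morph iter n (asigma D) : r s / r * s}.
Proof. by move=> r s; elim: n => //= n ->; rewrite rmorphM. Qed.

Lemma iter_asigmaZ n c r :
  iter n (asigma D) (c *: r) = c *: iter n (asigma D) r.
Proof. by elim: n => //= n ->; rewrite linearZ. Qed.

Lemma iter_asigma1 n : iter n (asigma D) 1 = 1.
Proof. by elim: n => //= n ->; rewrite rmorph1. Qed.

Lemma iter_asigma0 n : iter n (asigma D) 0 = 0.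
Proof. by elim: n => //= n ->; rewrite rmorph0. Qed.

Lemma iter_asigma_central n r : central r -> central (iter n (asigma D) r).
Proof.
move=> hr; elim: n => //= n IH s.
by rewrite -(asigmaVK D s) -!rmorphM IH.
Qed.

Lemma verma_coef_central n : central (verma_coef n).
Proof.
elim: n => [|n IH] r /=; first by rewrite mul0r mulr0.
rewrite mulrDl mulrDr -scalerAl -scalerAr IH; congr (_ + _).
exact/iter_asigma_central/ah_central.
Qed.

Lemma verma_ext s f g : f =1 g -> verma s f =1 verma s g.
Proof.
elim: s f g => [r|||||] //=.
- by move=> f g e n; rewrite e.
- by move=> f g e n; rewrite e.
- by move=> f g e [|n].
- by move=> s IHs t IHt f g e n; rewrite (IHs _ _ e) (IHt _ _ e).
- by move=> s IHs t IHt f g e; apply/IHs/IHt.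
- by move=> c s IH f g e n; rewrite (IH _ _ e).
Qed.

Lemma vermaD s f g n :
  verma s (fun m => f m + g m) n = verma s f n + verma s g n.
Proof.
elim: s f g n => [r|||||] //=.
- by move=> f g n; rewrite mulrDr.
- by move=> f g n; rewrite mulrDr.
- by move=> f g [|n]; rewrite ?addr0.
- by move=> s IHs t IHt f g n; rewrite IHs IHt addrACA.
- move=> s IHs t IHt f g n; rewrite -IHs.
  by apply: verma_ext => m; apply: IHt.
- by move=> c s IH f g n; rewrite IH scalerDr.
Qed.

Lemma vermaZ s c f n : verma s (fun m => c *: f m) n = c *: verma s f n.
Proof.
elim: s f n => [r|||||] //=.
- by move=> f n; rewrite scalerAr.
- by move=> f n; rewrite scalerAr.
- by move=> f [|n]; rewrite ?scaler0.
- by move=> s IHs t IHt f n; rewrite IHs IHt scalerDr.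
- move=> s IHs t IHt f n; rewrite -IHs.
  by apply: verma_ext => m; apply: IHt.
- by move=> a s IH f n; rewrite IH !scalerA mulrC.
Qed.

Lemma verma_eq s t : aterm_eq s t -> forall f, verma s f =1 verma t f.
Proof.
elim=> {s t} //=.
- by move=> s t _ IH f n; rewrite IH.
- by move=> s t u _ IH1 _ IH2 f n; rewrite IH1 IH2.
- by move=> s s' t t' _ IH1 _ IH2 f n; rewrite IH1 IH2.
- move=> s s' t t' _ IH1 _ IH2 f n.
  by rewrite IH1; apply: verma_ext => m; rewrite IH2.
- by move=> c s s' _ IH f n; rewrite IH.
- by move=> s t u f n; rewrite addrA.
- by move=> s t f n; rewrite addrC.
- by move=> s f n; rewrite iter_asigma0 mul0r add0r.
- by move=> s f n; rewrite scaleN1r addNr iter_asigma0 mul0r.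
- by move=> s f n; rewrite iter_asigma1 mul1r.
- by move=> s f; apply: verma_ext => n; rewrite iter_asigma1 mul1r.
- by move=> s t u f n; rewrite vermaD.
- by move=> a b s f n; rewrite scalerA.
- by move=> s f n; rewrite scale1r.
- by move=> c s t f n; rewrite scalerDr.
- by move=> a b s f n; rewrite scalerDl.
- by move=> c s t f n; rewrite vermaZ.
- by move=> r s f n; rewrite iter_asigmaD mulrDl.
- by move=> r s f n; rewrite iter_asigmaM mulrA.
- by move=> c r f n; rewrite iter_asigmaZ scalerAl.
- move=> r f n; rewrite -iterSr /= !mulrA.
  by congr (_ * _); rewrite (verma_coef_central n.+1).
- by move=> r f [|n] /=; rewrite ?mulr0 // -iterS iterSr asigmaVK.
- move=> f [|n] /=; rewrite ?scaler0 ?addr0 //.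
  by rewrite mulrDl scalerAl.
Qed.

Lemma ambiskew1_neq0 : (1 : ambiskew) != 0.
Proof.
apply/eqP => /ambiskew_ofP /verma_eq /(_ (fun=> 1) 0) /=.
by rewrite !mulr1; apply/eqP/oner_neq0.
Qed.

HB.instance Definition _ :=
  GRing.PzSemiRing_isNonZero.Build ambiskew ambiskew1_neq0.

Lemma ambiskew_scaleA a b x :
  ambiskew_scale a (ambiskew_scale b x) = ambiskew_scale (a * b) x.
Proof.
elim/ambiskewW: x => s; rewrite !ambiskew_scaleE.
exact/ambiskew_ofP/ae_scaleA.
Qed.

Lemma ambiskew_scale1 : left_id 1 ambiskew_scale.
Proof.
by elim/ambiskewW=> s; rewrite ambiskew_scaleE; apply/ambiskew_ofP/ae_scale1.
Qed.

Lemma ambiskew_scaleDr : right_distributive ambiskew_scale ambiskew_add.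
Proof.
move=> c; elim/ambiskewW=> s; elim/ambiskewW=> t.
by rewrite !(ambiskew_scaleE, ambiskew_addE); apply/ambiskew_ofP/ae_scaleDr.
Qed.

Lemma ambiskew_scaleDl x : {morph ambiskew_scale^~ x : a b / a + b}.
Proof.
elim/ambiskewW: x => s a b.
change (ambiskew_scale (a + b) (ambiskew_of s) =
  ambiskew_add (ambiskew_scale a (ambiskew_of s))
               (ambiskew_scale b (ambiskew_of s))).
by rewrite !(ambiskew_scaleE, ambiskew_addE); apply/ambiskew_ofP/ae_scaleDl.
Qed.

HB.instance Definition _ := GRing.Zmodule_isLmodule.Build k ambiskew
  ambiskew_scaleA ambiskew_scale1 ambiskew_scaleDr ambiskew_scaleDl.

Lemma ambiskew_scaleAl (c : k) (x y : ambiskew) : c *: (x * y) = (c *: x) * y.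
Proof.
elim/ambiskewW: x => s; elim/ambiskewW: y => t.
change (ambiskew_scale c (ambiskew_mul (ambiskew_of s) (ambiskew_of t)) =
  ambiskew_mul (ambiskew_scale c (ambiskew_of s)) (ambiskew_of t)).
rewrite !(ambiskew_scaleE, ambiskew_mulE).
exact/ambiskew_ofP/ae_scaleAl.
Qed.

HB.instance Definition _ :=
  GRing.Lmodule_isLalgebra.Build k ambiskew ambiskew_scaleAl.

Lemma ambiskew_scaleAr (c : k) (x y : ambiskew) : c *: (x * y) = x * (c *: y).
Proof.
elim/ambiskewW: x => s; elim/ambiskewW: y => t.
change (ambiskew_scale c (ambiskew_mul (ambiskew_of s) (ambiskew_of t)) =
  ambiskew_mul (ambiskew_of s) (ambiskew_scale c (ambiskew_of t))).
rewrite !(ambiskew_scaleE, ambiskew_mulE).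
exact/ambiskew_ofP/ae_scaleAr.
Qed.

HB.instance Definition _ :=
  GRing.Lalgebra_isAlgebra.Build k ambiskew ambiskew_scaleAr.

Definition Xplus : ambiskew := ambiskew_of AXplus.
Definition Xminus : ambiskew := ambiskew_of AXminus.
Definition iota_R (r : R) : ambiskew := ambiskew_of (AConst r).

Lemma iota_R_is_linear : linear iota_R.
Proof.
move=> c r s.
change (iota_R (c *: r + s) =
  ambiskew_add (ambiskew_scale c (iota_R r)) (iota_R s)).
rewrite ambiskew_scaleE ambiskew_addE; apply/ambiskew_ofP.
apply: ae_trans (ae_constD _ _) _.
exact: ae_add (ae_constZ _ _) (ae_refl _).
Qed.

HB.instance Definition _ :=
  GRing.isLinear.Build k R ambiskew _ iota_R iota_R_is_linear.

Lemma iota_R_is_monoid_morphism : monoid_morphism iota_R.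
Proof.
split=> // r s.
change (iota_R (r * s) = ambiskew_mul (iota_R r) (iota_R s)).
rewrite ambiskew_mulE.
exact/ambiskew_ofP/ae_constM.
Qed.

HB.instance Definition _ :=
  GRing.isMonoidMorphism.Build R ambiskew iota_R iota_R_is_monoid_morphism.

Lemma iota_R_inj : injective iota_R.
Proof.
move=> r s /ambiskew_ofP /verma_eq /(_ (fun=> 1) 0) /=.
by rewrite !mulr1.
Qed.

End Ambiskew.

(** * The Hopf ambiskew algebras of the theorem *)

Section HopfAmbiskew.
Variables (k : fieldType) (R : algType k) (HR : hopf R).

(* The admissible choices; h is in k(z-1), or is primitive with z = 1. *)
Definition hopf_ambiskew_choice (chi : {lrmorphism R -> k^o})
    (z yp ym h : R) : Prop :=
  [/\ [/\ grouplike HR z, grouplike HR yp & grouplike HR ym],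
      [/\ central z, central yp & central ym],
      z = yp * ym /\ chi yp = chi ym,
      central h
    & (exists c : k, h = c *: (z - 1)) \/ (primitive HR h /\ z = 1)].

(* [D] is the data (tau^l_chi, h, chi(y+)), and [HA] is a Hopf structure on
   its ambiskew algebra which extends that of R, with the X's skew primitive. *)
Definition hopf_ambiskew (chi : {lrmorphism R -> k^o}) (yp ym h : R)
    (D : ambiskew_data R) (HA : hopf (ambiskew D)) : Prop :=
  [/\ [/\ asigma D =1 tau_l HR chi, ah D = h & axi D = chi yp],
      hopf_morphism HR HA (@iota_R k R D),
      comul HA (Xplus D) = tens (Xplus D) 1 + tens (iota_R D yp) (Xplus D)
    & comul HA (Xminus D) = tens (Xminus D) 1 + tens (iota_R D ym) (Xminus D)].

End HopfAmbiskew.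

(* Main.v *)
Require Import Defs.
From HB Require Import structures.
From mathcomp Require Import all_boot all_algebra.
From mathcomp Require boolp classical_sets.

(* Existence. The comultiplication, the counit and the antipode of the
   ambiskew algebra are prescribed on the generators, and the Hopf axioms need
   only be checked there. What makes the relations compatible is that
   sigma = tau^l_chi satisfies Delta (sigma a) = sum sigma a_1 (x) a_2
   = sum a_1 (x) sigma a_2 when R is cocommutative; call such a map winding.
   The square of the antipode fixes R and rescales X+ and X-, so the antipode
   is bijective.

   Converse. The ambiskew algebra is a free left R-module on the X-^i X+^j, and
   one compares coordinates of tensors. Coassociativity at X+ and X- makes the
   r's and l's grouplike; after dividing by r, the comultiplication of the
   relations X r = theta r X shows that theta is winding, hence equal to
   tau^l_chi for chi = epsilon theta, and that y is central. The
   comultiplication of the relation between the new variables then gives the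
   conditions on h and xi, and also that r+ and r- commute. A winding
   composite of both automorphisms that preserves the counit is the identity.
   Finally Delta h = h (x) 1 + z (x) h and cocommutativity give
   h (x) (z - 1) = (z - 1) (x) h, so h is in k (z - 1) unless z = 1. *)

Set Implicit Arguments.
Unset Strict Implicit.
Unset Printing Implicit Defensive.

Import GRing.Theory.
Local Open Scope ring_scope.

(** * Linear maps on tensor products, Hopf algebras *)

Section LinearMaps.
Variables (k : fieldType) (U V W : lmodType k).

Lemma linear_idfun : linear (fun x : U => x).
Proof. by []. Qed.

Lemma linear_comp (L : {linear V -> W}) (f : U -> V) :
  linear f -> linear (fun x => L (f x)).
Proof. by move=> hf c x y; rewrite hf linearP. Qed.

Lemma linear_mull (A : algType k) (f : U -> A) b :
  linear f -> linear (fun x => f x * b).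
Proof. by move=> hf c x y; rewrite hf mulrDl -scalerAl. Qed.

Lemma linear_mulr (A : algType k) (f : U -> A) b :
  linear f -> linear (fun x => b * f x).
Proof. by move=> hf c x y; rewrite hf mulrDr -scalerAr. Qed.

Lemma linear_scalel (f : U -> k^o) (w : W) :
  linear f -> linear (fun x => (f x : k) *: w).
Proof. by move=> hf c x y; rewrite hf scalerDl -scalerA. Qed.

Lemma linear_scaler (f : U -> W) (a : k) :
  linear f -> linear (fun x => a *: f x).
Proof. by move=> hf c x y; rewrite hf scalerDr !scalerA mulrC. Qed.

Lemma linear_tensl (f : U -> V) (w : W) :
  linear f -> linear (fun x => tens (f x) w).
Proof. by move=> hf c x y; rewrite hf (tens_bilin V W).1. Qed.

Lemma linear_tensr (f : U -> W) (v : V) :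
  linear f -> linear (fun x => tens v (f x)).
Proof. by move=> hf c x y; rewrite hf (tens_bilin V W).2. Qed.

Lemma linear_tsum_fun (X : lmodType k) (f : U -> V -> W -> X) t :
  (forall v w, linear (fun x => f x v w)) -> linear (fun x => tsum (f x) t).
Proof.
move=> hf c x y; rewrite /tsum scaler_sumr -big_split /=.
by apply: eq_bigr => p _; rewrite hf.
Qed.

Lemma linear_tsum_arg (X : lmodType k) (f : V -> W -> X) (t : U -> tensor V W) :
  bilin f -> linear t -> linear (fun x => tsum f (t x)).
Proof. by move=> hf ht c x y; rewrite ht (tsum_linear hf). Qed.

End LinearMaps.

(** The rules run from specific to general: [linear_comp], whose outer map is any bundled linear
    map, is the last resort. *)
Ltac lin :=
  repeat match goal with
  | |- bilin _ => split => ? /=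
  | |- forall _, GRing.linear_for _ _ => move=> ? /=
  | |- forall _ _, GRing.linear_for _ _ => move=> ? ? /=
  | |- GRing.linear_for _ _ => first
    [ assumption
    | exact: linear_idfun
    | apply: linear_tensl
    | apply: linear_tensr
    | apply: linear_mull
    | apply: linear_mulr
    | apply: linear_scalel
    | apply: linear_scaler
    | (apply: linear_tsum_fun => ? ? /=)
    | apply: linear_tsum_arg
    | apply: linear_comp ]
  end.

(** * Calculus of tensors and of the maps induced by bilinear maps *)

Section TensorSums.
Variable k : fieldType.

Lemma tensDl (U V : lmodType k) (x y : U) (v : V) :
  tens (x + y) v = tens x v + tens y v.
Proof. by have := (tens_bilin U V).1 v 1 x y; rewrite !scale1r. Qed.

Lemma tensDr (U V : lmodType k) (u : U) (x y : V) :
  tens u (x + y) = tens u x + tens u y.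
Proof. by have := (tens_bilin U V).2 u 1 x y; rewrite !scale1r. Qed.

Lemma tensZl (U V : lmodType k) c (x : U) (v : V) :
  tens (c *: x) v = c *: tens x v.
Proof. by rewrite (GRing.scalable_linear ((tens_bilin U V).1 v)). Qed.

Lemma tensZr (U V : lmodType k) c (u : U) (x : V) :
  tens u (c *: x) = c *: tens u x.
Proof. by rewrite (GRing.scalable_linear ((tens_bilin U V).2 u)). Qed.

Lemma tensBl (U V : lmodType k) (x y : U) (v : V) :
  tens (x - y) v = tens x v - tens y v.
Proof. by rewrite tensDl -scaleN1r tensZl scaleN1r. Qed.

Lemma tensBr (U V : lmodType k) (u : U) (x y : V) :
  tens u (x - y) = tens u x - tens u y.
Proof. by rewrite tensDr -scaleN1r tensZr scaleN1r. Qed.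

Lemma eq_tsum (U V : lmodType k) (W : nmodType) (f g : U -> V -> W) t :
  (forall x y, f x y = g x y) -> tsum f t = tsum g t.
Proof. by move=> fg; apply: eq_bigr => p _; rewrite fg. Qed.

Lemma tsum_eq0 (U V : lmodType k) (W : nmodType) (f : U -> V -> W) t :
  (forall x y, f x y = 0) -> tsum f t = 0.
Proof. by move=> f0; apply: big1. Qed.

(* No bilinearity is needed: both sides use the same representative of t. *)
Lemma linear_tsum (U V W X : lmodType k) (L : W -> X) (f : U -> V -> W) t :
  linear L -> L (tsum f t) = tsum (fun x y => L (f x y)) t.
Proof.
move=> hL; have LD x y : L (x + y) = L x + L y.
  by have := hL 1 x y; rewrite !scale1r.
apply: (big_morph L LD).
by apply: (addIr (L 0)); rewrite -LD !add0r.
Qed.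

Lemma tsumD (U V W : lmodType k) (f : U -> V -> W) : bilin f ->
  {morph tsum f : x y / x + y}.
Proof. by move=> hf x y; have := tsum_linear hf 1 x y; rewrite !scale1r. Qed.

Lemma tsumZ (U V W : lmodType k) (f : U -> V -> W) c x : bilin f ->
  tsum f (c *: x) = c *: tsum f x.
Proof.
move=> hf; have h0 : tsum f 0 = 0.
  by apply: (addIr (tsum f 0)); rewrite -(tsumD hf) !add0r.
by have := tsum_linear hf c x 0; rewrite h0 !addr0.
Qed.

Lemma exchange_tsum (U V U' V' W : lmodType k) (f : U -> V -> U' -> V' -> W)
    t t' :
  tsum (fun x y => tsum (f x y) t') t =
  tsum (fun x' y' => tsum (fun x y => f x y x' y') t) t'.
Proof. exact: exchange_big. Qed.

Lemma tsum_tens (U V : lmodType k) (t : tensor U V) : tsum (@tens k U V) t = t.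
Proof. by rewrite -[RHS]tensor_reprK tensor_of_sum. Qed.

Lemma tmapE (U V U' V' : lmodType k) (f : U -> U') (g : V -> V') x y :
  linear f -> linear g -> tmap f g (tens x y) = tens (f x) (g y).
Proof. by move=> hf hg; rewrite /tmap tsumE //; lin. Qed.

Lemma tsum_tmap (U V U' V' W : lmodType k) (f : U -> U') (g : V -> V')
    (F : U' -> V' -> W) t :
  bilin F -> tsum F (tmap f g t) = tsum (fun x y => F (f x) (g y)) t.
Proof.
move=> hF; rewrite /tmap linear_tsum; last exact: tsum_linear.
by apply: eq_tsum => x y; rewrite tsumE.
Qed.

Lemma bilin_tmap (U V U' V' : lmodType k) (f : U -> U') (g : V -> V') :
  linear f -> linear g -> bilin (fun x y => tens (f x) (g y)).
Proof. by move=> hf hg; lin. Qed.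

Lemma tmapD (U V U' V' : lmodType k) (f : U -> U') (g : V -> V') :
  linear f -> linear g -> {morph tmap f g : x y / x + y}.
Proof. by move=> hf hg; apply/tsumD/bilin_tmap. Qed.

Lemma tmapZ (U V U' V' : lmodType k) (f : U -> U') (g : V -> V') c x :
  linear f -> linear g -> tmap f g (c *: x) = c *: tmap f g x.
Proof. by move=> hf hg; apply/tsumZ/bilin_tmap. Qed.

Lemma tens0l (U V : lmodType k) (v : V) : tens (0 : U) v = 0.
Proof. by rewrite -(scale0r 0) tensZl scale0r. Qed.

Lemma tens0r (U V : lmodType k) (u : U) : tens u (0 : V) = 0.
Proof. by rewrite -(scale0r 0) tensZr scale0r. Qed.

Lemma tmap_tmap (U V U' V' U'' V'' : lmodType k) (f : U -> U') (g : V -> V')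
    (f' : U' -> U'') (g' : V' -> V'') t : linear f' -> linear g' ->
  tmap f' g' (tmap f g t) = tsum (fun x y => tens (f' (f x)) (g' (g y))) t.
Proof. by move=> hf hg; apply: tsum_tmap; lin. Qed.

Lemma tassocE (U V W : lmodType k) t (w : W) :
  tassoc (tens t w) = tsum (fun (u : U) (v : V) => tens u (tens v w)) t.
Proof. by rewrite /tassoc tsumE //; lin. Qed.

Lemma tassoc_linear (U V W : lmodType k) : linear (@tassoc k U V W).
Proof. by apply: tsum_linear; lin. Qed.

Lemma tassocD (U V W : lmodType k) : {morph @tassoc k U V W : x y / x + y}.
Proof. by apply: tsumD; lin. Qed.

Lemma tsum_mul (A B : algType k) (W : lmodType k) (f : A -> B -> W) x y :
  bilin f ->
  tsum f ((x : tensor A B) * y) =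
  tsum (fun a b => tsum (fun a' b' => f (a * a') (b * b')) y) x.
Proof.
move=> hf; change (x * y) with (tmul x y); rewrite /tmul.
rewrite (linear_tsum _ _ (tsum_linear hf)).
apply: eq_tsum => a b; rewrite (linear_tsum _ _ (tsum_linear hf)).
by apply: eq_tsum => a' b'; rewrite tsumE.
Qed.

(** Multiplicativity of an induced map need only be checked on pure tensors. The product [m] on [W]
    is any bilinear map, which covers [tmul] on a tensor product of two different algebras. *)
Lemma tsumM (A B : algType k) (W : lmodType k) (m : W -> W -> W)
    (f g h : A -> B -> W) :
  bilin m -> bilin h ->
  (forall a b a' b', h (a * a') (b * b') = m (f a b) (g a' b')) ->
  forall x y : tensor A B, tsum h (x * y) = m (tsum f x) (tsum g y).
Proof.
move=> hm hh hM x y; rewrite tsum_mul // [RHS](linear_tsum _ x (hm.1 _)).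
apply: eq_tsum => a b; rewrite [RHS](linear_tsum _ y (hm.2 _)).
exact: eq_tsum.
Qed.

Lemma tmul_bilin (A B : algType k) : bilin (@tmul k A B).
Proof. by split=> ?; [apply: tmul_linear_l | apply: tmul_linear_r]. Qed.

Lemma tmapM (A B A' B' : algType k) (f : A -> A') (g : B -> B') :
  linear f -> linear g -> {morph f : x y / x * y} -> {morph g : x y / x * y} ->
  {morph tmap f g : x y / x * y}.
Proof.
move=> hf hg fM gM x y.
apply: (tsumM (tmul_bilin A' B')); first exact: bilin_tmap.
by move=> a b a' b'; rewrite fM gM tmul_tens.
Qed.

Lemma tassocM (A : algType k) : {morph @tassoc k A A A : x y / x * y}.
Proof.
move=> x y; apply: (tsumM (tmul_bilin A (tensor A A))); first by lin.
move=> t w t' w'; apply: (tsumM (tmul_bilin A (tensor A A))); first by lin.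
by move=> a b a' b'; rewrite tmul_tens tensM.
Qed.

End TensorSums.

(** * Sweedler calculus, antipode, grouplike elements and winding maps *)

Section HopfTheory.
Variables (k : fieldType) (A : algType k) (H : hopf A).
Local Notation "'Δ' x" := (comul H x) (at level 10, x at next level).
Local Notation "'ε' x" := (counit H x : k) (at level 10, x at next level).
Local Notation S := (antipode H).

(** Coassociativity in Sweedler form: the map induced by the trilinear [f] on
    [tensor A (tensor A A)] is applied to both sides of [comulA]. *)
Lemma comul_assoc (W : lmodType k) (f : A -> A -> A -> W) a :
  (forall y z, linear (fun x => f x y z)) ->
  (forall x z, linear (fun y => f x y z)) ->
  (forall x y, linear (fun z => f x y z)) ->
  tsum (fun x y => tsum (fun x1 x2 => f x1 x2 y) (Δ x)) (Δ a) =
  tsum (fun x y => tsum (fun y1 y2 => f x y1 y2) (Δ y)) (Δ a).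
Proof.
move=> h1 h2 h3.
have hb x : bilin (f x) by split=> ?.
have hF : bilin (fun x w => tsum (f x) w) by lin.
have := congr1 (tsum (fun x w => tsum (f x) w)) (comulA H a).
rewrite [X in _ = X -> _]tsum_tmap // => <-.
rewrite /tmap (linear_tsum _ _ (@tassoc_linear k A A A)).
rewrite (linear_tsum _ _ (tsum_linear hF)).
apply: eq_tsum => x y; rewrite tassocE (linear_tsum _ _ (tsum_linear hF)).
by apply: eq_tsum => x1 x2; rewrite tsumE // tsumE.
Qed.

Lemma counit_suml (W : lmodType k) (f : A -> W) a : linear f ->
  tsum (fun x y => ε x *: f y) (Δ a) = f a.
Proof.
move=> hf; rewrite -{2}(counitl H a) linear_tsum //; apply: eq_tsum => x y.
by rewrite (GRing.scalable_linear hf).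
Qed.

Lemma counit_sumr (W : lmodType k) (f : A -> W) a : linear f ->
  tsum (fun x y => ε y *: f x) (Δ a) = f a.
Proof.
move=> hf; rewrite -{2}(counitr H a) linear_tsum //; apply: eq_tsum => x y.
by rewrite (GRing.scalable_linear hf).
Qed.

(** In the convolution algebra of linear maps from [A] to [B], a left and a right inverse of [G]
    coincide: F = F * (G * K) = (F * G) * K = K. *)
Lemma convolution_inverse_uniq (B : algType k) (F G K : A -> B) :
  linear F -> linear G -> linear K ->
  (forall a, tsum (fun x y => F x * G y) (Δ a) = (ε a)%:A) ->
  (forall a, tsum (fun x y => G x * K y) (Δ a) = (ε a)%:A) ->
  F =1 K.
Proof.
move=> hF hG hK FG GK a.
rewrite -(counit_sumr a hF) -[RHS](counit_suml a hK).
transitivity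
  (tsum (fun x y => tsum (fun u v => F x * G u * K v) (Δ y)) (Δ a)).
  apply: eq_tsum => x y; rewrite -[LHS]mulr_algr -GK.
  rewrite (linear_tsum _ _ (L := fun z => F x * z)); last by lin.
  by apply: eq_tsum => u v; rewrite mulrA.
rewrite -(comul_assoc (f := fun x y z => F x * G y * K z)); try lin.
apply: eq_tsum => x y; rewrite -[RHS]mulr_algl -FG.
by rewrite (linear_tsum _ _ (L := fun z => z * K y)) //; lin.
Qed.

Lemma antipode1 : S 1 = 1.
Proof.
have := antipodel H 1; rewrite rmorph1 [counit H _]rmorph1.
rewrite tsumE ?mulr1 ?scale1r //.
by lin.
Qed.

(** S(ab) = sum S(b_1) b_2 S(a b_3) = sum S(b_1) S(a_1) a_2 b_2 S(a_3 b_3), and the product of the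
    last three factors contracts to counits. *)
Lemma antipodeM (a b : A) : S (a * b) = S b * S a.
Proof.
have sum_antipodel (L : A -> A) x : linear L ->
    tsum (fun x1 x2 => L (S x1 * x2)) (Δ x) = ε x *: L 1.
  move=> hL; rewrite -linear_tsum // antipodel.
  by rewrite (GRing.scalable_linear hL).
transitivity (tsum (fun u v => tsum (fun v1 v2 => S u * v1 * S (a * v2)) (Δ v))
    (Δ b)).
  rewrite -(comul_assoc (f := fun x y z => S x * y * S (a * z))); try lin.
  rewrite -[LHS](counit_suml (f := fun y => S (a * y))); last by lin.
  apply: eq_tsum => u v.
  rewrite (sum_antipodel (fun z => z * S (a * v))); last by lin.
  by rewrite mul1r.
rewrite -[RHS](counit_sumr (f := fun x => S x * S a)); last by lin.
apply: eq_tsum => u v.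
(* Evaluated on the three parts of [a], [g] gives the left side when its first two arguments are
   contracted through [S x * y], and the right side when its last two are contracted with the parts
   of [v]. *)
pose g (x y z : A) :=
  tsum (fun v1 v2 => S u * S x * (y * v1 * S (z * v2))) (Δ v).
transitivity (tsum (fun x y => tsum (fun y1 y2 => g x y1 y2) (Δ y)) (Δ a)).
  rewrite -(comul_assoc (f := g)); try by rewrite /g; lin.
  rewrite -[LHS](counit_suml
    (f := fun y : A => tsum (fun v1 v2 => S u * v1 * S (y * v2)) (Δ v)));
    last by lin.
  apply: eq_tsum => x y; rewrite /g exchange_tsum.
  rewrite (linear_tsum (L := fun z => ε x *: z)); last by lin.
  apply: eq_tsum => v1 v2.
  rewrite -[X in X * v1]mulr1.
  rewrite -(sum_antipodel (fun z => S u * z * v1 * S (y * v2)));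
    last by lin.
  by apply: eq_tsum => x1 x2; rewrite !mulrA.
rewrite -(counit_sumr (f := fun x => ε v *: (S u * S x))); last by lin.
apply: eq_tsum => x y; rewrite scalerA -[X in X *: _](rmorphM (counit H)).
rewrite -[RHS]mulr_algr -antipoder.
rewrite rmorphM tsum_mul; last by lin.
rewrite (linear_tsum (L := fun z => S u * S x * z)); last by lin.
apply: eq_tsum => y1 y2; rewrite (linear_tsum (L := fun z => S u * S x * z)) //.
by lin.
Qed.

Lemma grouplike_counit g : grouplike H g -> ε g = 1.
Proof.
move=> [g0 hg]; have := counitl H g; rewrite hg tsumE; last first.
  by lin.
move=> eg; have : (ε g - 1) *: g == 0.
  by rewrite scalerBl [X in X - _]eg scale1r subrr.
by rewrite scaler_eq0 (negPf g0) orbF subr_eq0 => /eqP.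
Qed.

Lemma grouplike_mulVr g : grouplike H g -> S g * g = 1.
Proof.
move=> hg; have := antipodel H g; rewrite hg.2 tsumE; last by lin.
by rewrite grouplike_counit // scale1r.
Qed.

Lemma grouplike_mulrV g : grouplike H g -> g * S g = 1.
Proof.
move=> hg; have := antipoder H g; rewrite hg.2 tsumE; last by lin.
by rewrite grouplike_counit // scale1r.
Qed.

Lemma grouplike_of_counit g :
  comul H g = tens g g -> ε g = 1 -> grouplike H g.
Proof.
move=> hg eg; split=> //; apply/eqP => g0.
by move: eg; rewrite g0 [counit H 0]raddf0 => /eqP; rewrite eq_sym oner_eq0.
Qed.

Lemma grouplikeM g h : grouplike H g -> grouplike H h -> grouplike H (g * h).
Proof.
move=> hg hh; apply: grouplike_of_counit.
  by rewrite rmorphM /= hg.2 hh.2 tensM.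
by rewrite [counit H _]rmorphM /= !grouplike_counit // mulr1.
Qed.

(** Since [Δ] is multiplicative, [Δ (S g)] and [tens (S g) (S g)] are both inverse to [Δ g], which
    is [tens g g]. *)
Lemma grouplikeV g : grouplike H g -> grouplike H (S g).
Proof.
move=> hg; have gV := grouplike_mulVr hg; have Vg := grouplike_mulrV hg.
apply: grouplike_of_counit; last first.
  have := congr1 (counit H) gV; rewrite rmorphM rmorph1 /=.
  by rewrite [counit H g](grouplike_counit hg) mulr1.
rewrite -[LHS]mulr1.
have <- : (tens g g : tensor A A) * tens (S g) (S g) = 1 by rewrite tensM Vg.
by rewrite -hg.2 mulrA -rmorphM gV rmorph1 mul1r.
Qed.

(** These are the endomorphisms of [A] as a right comodule over itself. By [winding_counit] they
    have the form a |-> sum λ(a_1) a_2 with λ the composite of [T] and the counit. *)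
Definition winding (T : A -> A) : Prop :=
  linear T /\ forall a, tsum (fun x y => tens (T x) y) (Δ a) = Δ (T a).

Lemma winding_suml (T : A -> A) (W : lmodType k) (f : A -> A -> W) a :
  winding T -> bilin f ->
  tsum f (Δ (T a)) = tsum (fun x y => f (T x) y) (Δ a).
Proof.
move=> hT hf; rewrite -hT.2 (linear_tsum _ _ (tsum_linear hf)).
by apply: eq_tsum => x y; rewrite tsumE.
Qed.

Lemma winding_counit (T : A -> A) a :
  winding T -> T a = tsum (fun x y => ε (T x) *: y) (Δ a).
Proof.
move=> hT; rewrite -[LHS](counitl H) (winding_suml a hT) //.
by lin.
Qed.

Lemma winding_grouplike (T : A -> A) g :
  winding T -> grouplike H g -> T g = ε (T g) *: g.
Proof.
move=> hT hg; rewrite {1}(winding_counit g hT) hg.2 tsumE //.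
have h1 : linear (fun x => counit H (T x)).
  by have Tl := hT.1; lin.
by lin.
Qed.

(** The identity for [T], taken at [V a], becomes the one for [V] once [V] is applied to the left
    tensor factor. *)
Lemma winding_can (T V : A -> A) :
  cancel T V -> cancel V T -> winding T -> winding V.
Proof.
move=> TK VK [Tl hT].
have hV : linear V.
  by move=> c x y; apply: (can_inj TK); rewrite Tl !VK.
split=> // a; rewrite -{1}(VK a) (winding_suml _ (conj Tl hT)); last by lin.
by rewrite (eq_tsum (g := @tens k A A)) ?tsum_tens // => x y; rewrite TK.
Qed.

(** A winding map is determined by its composite with the counit, by [winding_counit]. *)
Lemma winding_counit_id (T : A -> A) :
  winding T -> (forall a, ε (T a) = ε a) -> T =1 id.
Proof.
move=> hT eT a; rewrite (winding_counit a hT) -[RHS](counitl H).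
by apply: eq_tsum => x y; rewrite eT.
Qed.

Lemma winding_comp (T V : A -> A) : winding T -> winding V -> winding (T \o V).
Proof.
move=> hT hV; have Tl := hT.1; have Vl := hV.1; split=> [c x y|a] /=.
  by rewrite Vl Tl.
rewrite -hT.2 (winding_suml _ hV) //; lin.
Qed.

(** By coassociativity both sides are the sum of χ(a_1) a_2 (x) a_3. *)
Lemma winding_tau (χ : {lrmorphism A -> k^o}) : winding (tau_l H χ).
Proof.
split=> [|a]; first by apply: linear_tsum_arg; lin.
rewrite /tau_l linear_tsum; last by lin.
pose f x y z : tensor A A := (χ x : k) *: tens y z.
transitivity (tsum (fun x y => tsum (fun x1 x2 => f x1 x2 y) (Δ x)) (Δ a)).
  apply: eq_tsum => x y; rewrite (linear_tsum (L := fun z => tens z y)).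
    by apply: eq_tsum => u v; rewrite tensZl.
  by lin.
rewrite comul_assoc /f; try lin.
apply: eq_tsum => x y; rewrite linearZ /=.
by rewrite -[in RHS](tsum_tens (Δ y)) [RHS]linear_tsum //; lin.
Qed.

Lemma tau_l1 (χ : {lrmorphism A -> k^o}) : tau_l H χ 1 = 1.
Proof.
rewrite /tau_l rmorph1 tsumE; last by lin.
by rewrite [χ 1]rmorph1 scale1r.
Qed.

Lemma tau_lM (χ : {lrmorphism A -> k^o}) : {morph tau_l H χ : x y / x * y}.
Proof.
move=> x y; rewrite /tau_l rmorphM.
apply: (tsumM (mul_bilin A)); first by lin.
by move=> a b a' b'; rewrite [χ _]rmorphM -scalerAl -scalerAr scalerA.
Qed.

(** * Consequences of cocommutativity *)

Section Cocommutative.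
Hypothesis Hc : cocommutative H.

Lemma comul_swap (W : lmodType k) (f : A -> A -> W) a :
  bilin f -> tsum f (Δ a) = tsum (fun x y => f y x) (Δ a).
Proof.
move=> hf; rewrite -{1}Hc (linear_tsum _ _ (tsum_linear hf)).
by apply: eq_tsum => x y; rewrite tsumE.
Qed.

(** Swapping the tensor factors before and after [winding_suml] moves [T] to the right factor. *)
Lemma winding_sumr (T : A -> A) (W : lmodType k) (f : A -> A -> W) a :
  winding T -> bilin f ->
  tsum f (Δ (T a)) = tsum (fun x y => f x (T y)) (Δ a).
Proof.
move=> hT hf; have Tl := hT.1; have fb : bilin (fun x y => f y x).
  by split=> ?; [apply: hf.2 | apply: hf.1].
rewrite comul_swap // (winding_suml _ hT) //.
apply: comul_swap; split=> v c x y; rewrite ?Tl; [exact: fb.1 | exact: hf.1].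
Qed.

(** The identity is a left convolution inverse of [S], and [S \o S] a right one: sum S(x_1)
    S(S(x_2)) = S(sum S(x_2) x_1), which cocommutativity turns into S(ε(x) 1). *)
Lemma antipodeK : involutive S.
Proof.
move=> a; symmetry.
apply: (@convolution_inverse_uniq A id S (S \o S)) => //=; try lin.
- exact: antipoder.
- move=> x; under eq_tsum => u v do rewrite -antipodeM.
  rewrite -linear_tsum; last by lin.
  rewrite -(comul_swap (f := fun u v => S u * v)); last by lin.
  by rewrite antipodel linearZ /= antipode1.
Qed.

(** The map x |-> T(S(T x)) is a left convolution inverse of the identity: the inner [T] is absorbed
    into the argument of [Δ], the outer one is factored out, and the [V] left on the right factor is
    absorbed in turn. The antipode of an ambiskew algebra needs this to respect X r = σ(r) X. *)
Lemma winding_antipode (T : {lrmorphism A -> A}) (V : A -> A) a :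
  cancel T V -> cancel V T -> winding T -> T (S (T a)) = S a.
Proof.
move=> TK VK hT; have hV := winding_can TK VK hT; have Vl := hV.1.
apply: (@convolution_inverse_uniq A (fun x => T (S (T x))) id S); try by lin.
- move=> x.
  rewrite -(winding_suml (f := fun u v => T (S u) * v)) //; last by lin.
  under eq_tsum => u v do rewrite -[X in _ * X]VK -rmorphM.
  rewrite -(linear_tsum (L := T)); last by lin.
  rewrite -(winding_sumr (f := fun u v => S u * v)) //; last by lin.
  by rewrite TK antipodel linearZ /= rmorph1.
- exact: antipoder.
Qed.

End Cocommutative.
End HopfTheory.

(** A bialgebra map preserves antipodes, since composing it with the antipode on either side gives a
    convolution inverse of it. *)
Lemma antipode_morphism (k : fieldType) (A B : algType k) (HA : hopf A)
    (HB : hopf B) (f : {lrmorphism A -> B}) :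
  (forall a, comul HB (f a) = tmap f f (comul HA a)) ->
  (forall a, counit HB (f a) = counit HA a) ->
  hopf_morphism HA HB f.
Proof.
move=> fD fe; split=> // a.
apply: (@convolution_inverse_uniq k A HA B (fun x => antipode HB (f x)) f
  (fun x => f (antipode HA x))); try by lin.
- move=> x; rewrite -fe -antipodel fD tsum_tmap //.
  by lin.
- move=> x; under eq_tsum => u v do rewrite -rmorphM.
  rewrite -(linear_tsum (L := f)); last by lin.
  by rewrite antipoder linearZ /= rmorph1.
Qed.

(** * The universal property of ambiskew algebras *)

Section AmbiskewTheory.
Variables (k : fieldType) (R : algType k) (D : ambiskew_data R).
Local Notation A := (ambiskew D).
Local Notation ι := (iota_R D).
Local Notation P := (Xplus D).
Local Notation M := (Xminus D).

Lemma ambiskew_of_add s t :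
  ambiskew_of D (AAdd s t) = ambiskew_of D s + ambiskew_of D t.
Proof. by rewrite -ambiskew_addE. Qed.

Lemma ambiskew_of_mul s t :
  ambiskew_of D (AMul s t) = ambiskew_of D s * ambiskew_of D t.
Proof. by rewrite -ambiskew_mulE. Qed.

Lemma ambiskew_of_scale c s :
  ambiskew_of D (AScale c s) = c *: ambiskew_of D s.
Proof. by rewrite -ambiskew_scaleE. Qed.

Lemma Xplus_iota r : P * ι r = ι (asigma D r) * P.
Proof. by rewrite -!ambiskew_of_mul; apply/ambiskew_ofP/ae_Xplus. Qed.

Lemma Xminus_iota r : M * ι r = ι (asigmaV D r) * M.
Proof. by rewrite -!ambiskew_of_mul; apply/ambiskew_ofP/ae_Xminus. Qed.

Lemma iota_Xplus a : ι a * P = P * ι (asigmaV D a).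
Proof. by rewrite Xplus_iota asigmaVK. Qed.

Lemma iota_Xminus a : ι a * M = M * ι (asigma D a).
Proof. by rewrite Xminus_iota asigmaK. Qed.

Lemma Xplus_Xminus : P * M = ι (ah D) + axi D *: (M * P).
Proof.
rewrite -!ambiskew_of_mul -ambiskew_of_scale -ambiskew_of_add.
exact/ambiskew_ofP/ae_Xpm.
Qed.

Lemma ambiskew_gen_ind (Q : A -> Prop) :
  (forall r, Q (ι r)) -> Q P -> Q M ->
  (forall x y, Q x -> Q y -> Q (x + y)) ->
  (forall x y, Q x -> Q y -> Q (x * y)) -> forall x, Q x.
Proof.
move=> Qr Qp Qm QD QM; elim/ambiskewW; elim=> [r|||||].
- exact: Qr.
- exact: Qp.
- exact: Qm.
- by move=> s hs t ht; rewrite ambiskew_of_add; apply: QD.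
- by move=> s hs t ht; rewrite ambiskew_of_mul; apply: QM.
- move=> c s hs; rewrite ambiskew_of_scale -mulr_algl -(rmorph1 ι) -linearZ.
  exact: QM (Qr _) hs.
Qed.

Section Lift.
Variables (B : lmodType k) (m : B -> B -> B) (φ : R -> B) (p q : B).
Hypothesis mb : bilin m.
Hypothesis mA : associative m.
Hypothesis φl : linear φ.
Hypothesis φM : forall r s, φ (r * s) = m (φ r) (φ s).
Hypothesis φ1l : forall b, m (φ 1) b = b.
Hypothesis φ1r : forall b, m b (φ 1) = b.
Hypothesis hp : forall r, m p (φ r) = m (φ (asigma D r)) p.
Hypothesis hq : forall r, m q (φ r) = m (φ (asigmaV D r)) q.
Hypothesis hpq : m p q = φ (ah D) + axi D *: m q p.

Fixpoint aterm_eval (s : aterm R) : B :=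
  match s with
  | AConst r => φ r
  | AXplus => p
  | AXminus => q
  | AAdd s t => aterm_eval s + aterm_eval t
  | AMul s t => m (aterm_eval s) (aterm_eval t)
  | AScale c s => c *: aterm_eval s
  end.

Lemma aterm_eval_eq s t : aterm_eq D s t -> aterm_eval s = aterm_eval t.
Proof.
have ml1 x y b : m (x + y) b = m x b + m y b.
  by have := mb.1 b 1 x y; rewrite !scale1r.
have mr1 x y b : m b (x + y) = m b x + m b y.
  by have := mb.2 b 1 x y; rewrite !scale1r.
have φD x y : φ (x + y) = φ x + φ y.
  by have := φl 1 x y; rewrite !scale1r.
have φZ c x : φ (c *: x) = c *: φ x by rewrite (GRing.scalable_linear φl).
have φ0 : φ 0 = 0 by rewrite -(scale0r 0) φZ scale0r.
elim=> {s t} //=.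
- by move=> s t u _ -> _ ->.
- by move=> s s' t t' _ -> _ ->.
- by move=> s s' t t' _ -> _ ->.
- by move=> c s s' _ ->.
- by move=> s t u; rewrite addrA.
- by move=> s t; rewrite addrC.
- by move=> s; rewrite φ0 add0r.
- by move=> s; rewrite φ0 scaleN1r addNr.
- by move=> a b s; rewrite scalerA.
- by move=> s; rewrite scale1r.
- by move=> c s t; rewrite scalerDr.
- by move=> a b s; rewrite scalerDl.
- by move=> c s t; rewrite (GRing.scalable_linear (mb.1 _)).
- by move=> c s t; rewrite (GRing.scalable_linear (mb.2 _)).
Qed.

(** The product [m] is any associative bilinear map, so that the opposite product of an algebra can
    serve too; the antipode is constructed in that way. *)
Lemma ambiskew_lift :
  exists F : {linear A -> B},
    [/\ forall r, F (ι r) = φ r, F P = p, F M = q &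
        forall x y, F (x * y) = m (F x) (F y)].
Proof.
pose F0 (x : A) := aterm_eval (ambiskew_repr x).
have F0E s : F0 (ambiskew_of D s) = aterm_eval s.
  exact/aterm_eval_eq/ambiskew_repr_of.
have Fl : linear F0.
  move=> c; elim/ambiskewW=> s; elim/ambiskewW=> t.
  by rewrite -ambiskew_of_scale -ambiskew_of_add !F0E.
pose F := HB.pack_for {linear A -> B} F0 (GRing.isLinear.Build k A B _ F0 Fl).
exists F; split; by move=> *; rewrite /= F0E.
Qed.

End Lift.

Lemma ambiskew_lrmorphism (B : algType k) (φ : {lrmorphism R -> B}) (p q : B) :
  (forall r, p * φ r = φ (asigma D r) * p) ->
  (forall r, q * φ r = φ (asigmaV D r) * q) ->
  p * q = φ (ah D) + axi D *: (q * p) ->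
  exists F : {lrmorphism A -> B},
    [/\ forall r, F (ι r) = φ r, F P = p & F M = q].
Proof.
move=> hp hq hpq.
have [||F [Fr FP FM Fmul]] := @ambiskew_lift B *%R φ p q (mul_bilin B)
  (@mulrA B) (linearP φ) (rmorphM φ) _ _ hp hq hpq.
- by move=> b; rewrite rmorph1 mul1r.
- by move=> b; rewrite rmorph1 mulr1.
have F1 : monoid_morphism F.
  by split=> //; rewrite -(rmorph1 ι) Fr rmorph1.
pose G := HB.pack_for {lrmorphism A -> B} (F : A -> B)
  (GRing.isLinear.Build k A B _ F (linearP F))
  (GRing.isMonoidMorphism.Build A B F F1).
by exists G.
Qed.

End AmbiskewTheory.

(** * The Hopf structure *)

Section SkewPrimitive.
Variables (k : fieldType) (R A : algType k) (HR : hopf R).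
Hypothesis Hc : cocommutative HR.
Variables (ι : {lrmorphism R -> A}).

Lemma tmap_lrmorphismM : {morph tmap ι ι : x y / x * y}.
Proof. by apply: tmapM; [lin | lin | exact: rmorphM | exact: rmorphM]. Qed.

(** Compatibility of the comultiplication with X r = T(r) X. The summand with [X] on the left uses
    that [T] is winding; the other one also uses cocommutativity and the centrality of [y]. *)
Lemma skew_primitive_comm (T : R -> R) (X : A) (y r : R) :
  winding HR T -> central y -> (forall r, X * ι r = ι (T r) * X) ->
  (tens X 1 + tens (ι y) X) * tmap ι ι (comul HR r) =
  tmap ι ι (comul HR (T r)) * (tens X 1 + tens (ι y) X).
Proof.
move=> hT hy hX; rewrite mulrDl mulrDr; congr (_ + _).
- rewrite /tmap (linear_tsum (L := fun z => tens X 1 * z)); last by lin.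
  rewrite (linear_tsum (L := fun z => z * tens X 1)); last by lin.
  rewrite (winding_suml r hT); last by lin.
  by apply: eq_tsum => u v; rewrite !tensM hX mul1r mulr1.
- rewrite /tmap (linear_tsum (L := fun z => tens (ι y) X * z)); last by lin.
  rewrite (linear_tsum (L := fun z => z * tens (ι y) X)); last by lin.
  rewrite (winding_sumr Hc r hT); last by lin.
  by apply: eq_tsum => u v; rewrite !tensM hX -!rmorphM hy.
Qed.

End SkewPrimitive.

Section HopfStructure.
Variables (k : fieldType) (R : algType k) (HR : hopf R).
Hypothesis Hc : cocommutative HR.
Variable D : ambiskew_data R.
Variables yp ym : R.
Hypothesis σw : winding HR (asigma D).
Hypothesis gp : grouplike HR yp.
Hypothesis gm : grouplike HR ym.
Hypothesis cp : central yp.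
Hypothesis cm : central ym.
Hypothesis σp : asigma D yp = axi D *: yp.
Hypothesis σm : asigma D ym = axi D *: ym.
Hypothesis hD : comul HR (ah D) = tens (ah D) 1 + tens (yp * ym) (ah D).

Local Notation A := (ambiskew D).
Local Notation ι := (iota_R D).
Local Notation P := (Xplus D).
Local Notation M := (Xminus D).
Local Notation σ := (asigma D).
Local Notation τ := (asigmaV D).
Local Notation ξ := (axi D).
Local Notation h := (ah D).
Local Notation S := (antipode HR).

Let τw : winding HR τ := winding_can (@asigmaK _ _ D) (@asigmaVK _ _ D) σw.

Lemma asigmaV_scaled y c : c != 0 -> σ y = c *: y -> τ y = c^-1 *: y.
Proof.
move=> c0 hy; have {1}-> : y = c^-1 *: σ y.
  by rewrite hy scalerA mulVf // scale1r.
by rewrite (GRing.scalable_linear τw.1) asigmaK.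
Qed.

(** In the relation between X+ and X- the mixed terms cancel: moving [ym] past X+ costs [ξ], and
    moving [yp] past X- costs the inverse of [ξ]. What remains is the hypothesis [hD] on [h]. *)
Lemma ambiskew_comul : exists Δ : {lrmorphism A -> tensor A A},
  [/\ forall r, Δ (ι r) = tmap ι ι (comul HR r),
      Δ P = tens P 1 + tens (ι yp) P & Δ M = tens M 1 + tens (ι ym) M].
Proof.
pose φ0 r : tensor A A := tmap ι ι (comul HR r).
have φl : linear φ0 by apply: linear_tsum_arg; lin.
have φm : monoid_morphism φ0.
  split; last by move=> r s; rewrite /φ0 rmorphM (tmap_lrmorphismM ι).
  by rewrite /φ0 rmorph1 tmapE ?rmorph1 //; lin.
pose φ := HB.pack_for {lrmorphism R -> tensor A A} φ0
  (GRing.isLinear.Build k R (tensor A A) _ φ0 φl)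
  (GRing.isMonoidMorphism.Build R (tensor A A) φ0 φm).
have hp r := skew_primitive_comm Hc r σw cp (@Xplus_iota _ _ D).
have hm r := skew_primitive_comm Hc r τw cm (@Xminus_iota _ _ D).
have [|F [Fr FP FM]] := ambiskew_lrmorphism (φ := φ) hp hm; last by exists F.
rewrite /= /φ0 hD !mulrDl !mulrDr !tensM !mul1r !mulr1 -!rmorphM.
rewrite (tmapD (linearP ι) (linearP ι)).
rewrite !tmapE ?rmorph1; try lin.
rewrite Xplus_iota Xminus_iota σm (asigmaV_scaled (axi_neq0 D) σp).
rewrite !linearZ /= -!scalerAl.
rewrite !tensZl Xplus_Xminus !tensDl !tensDr !tensZl !tensZr !scalerDr.
rewrite !scalerA mulfV ?axi_neq0 // scale1r (cm yp).
rewrite -!addrA; congr (_ + _).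
rewrite [RHS]addrCA; congr (_ + _).
by rewrite addrCA [RHS]addrCA; congr (_ + _); rewrite addrCA.
Qed.

(** The counit axiom at [h] reads h = ε(h) 1 + ε(yp ym) h, and the grouplike [yp * ym] has counit
    1. *)
Lemma counit_ah : counit HR h = 0.
Proof.
have := counitl HR h.
rewrite hD (tsumD (f := fun x y => (counit HR x : k) *: y)); last by lin.
rewrite !tsumE; try lin.
rewrite (grouplike_counit (grouplikeM gp gm)) scale1r => /eqP.
by rewrite -subr_eq0 addrK scaler_eq0 oner_eq0 orbF => /eqP.
Qed.

Lemma ambiskew_counit : exists ε : {lrmorphism A -> k^o},
  [/\ forall r, ε (ι r) = counit HR r, ε P = 0 & ε M = 0].
Proof.
apply: ambiskew_lrmorphism => [r|r|]; rewrite ?mul0r ?mulr0 //.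
by rewrite counit_ah scaler0 addr0.
Qed.

Lemma antipode_ah : S h = - (S (yp * ym) * h).
Proof.
have := antipodel HR h.
rewrite hD (tsumD (f := fun x y => S x * y)); last by lin.
rewrite !tsumE; try lin.
by rewrite counit_ah scale0r mulr1 => /eqP; rewrite addr_eq0 => /eqP.
Qed.

Lemma central_antipode y : central y -> central (S y).
Proof. by move=> cy r; rewrite -(antipodeK Hc r) -!antipodeM cy. Qed.

Lemma lrmorphism_scaledV (T : {lrmorphism R -> R}) y c :
  grouplike HR y -> c != 0 -> T y = c *: y -> T (S y) = c^-1 *: S y.
Proof.
move=> gy c0 Ty; rewrite -[LHS]mulr1 -(grouplike_mulrV gy) mulrA.
have -> : T (S y) * y = c^-1 *: 1.
  rewrite -(rmorph1 T) -(grouplike_mulVr gy) rmorphM /= Ty -scalerAr scalerA.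
  by rewrite mulVf // scale1r.
by rewrite -scalerAl mul1r.
Qed.

(** The values on X+ and X- are those forced by the antipode axioms; the universal property is
    applied to [A] with the opposite product. *)
Lemma ambiskew_antipode : exists F : {linear A -> A},
  [/\ forall r, F (ι r) = ι (S r), F P = - (ι (S yp) * P),
      F M = - (ι (S ym) * M) & forall x y, F (x * y) = F y * F x].
Proof.
have cSp := central_antipode cp; have cSm := central_antipode cm.
have σV a := winding_antipode Hc a (@asigmaK _ _ D) (@asigmaVK _ _ D) σw.
have Sσ r : σ (S (σ r)) = S r by exact: σV.
have Sτ r : τ (S (τ r)) = S r.
  by rewrite -[in RHS](asigmaVK D r) -(σV (τ r)) asigmaVK // asigmaK.
have τl := τw.1.
apply: (ambiskew_lift (m := fun x y : A => y * x) (φ := fun r => ι (S r))).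
- by lin.
- by move=> x y z; rewrite mulrA.
- by lin.
- by move=> r s; rewrite antipodeM rmorphM.
- by move=> b; rewrite antipode1 rmorph1 mulr1.
- by move=> b; rewrite antipode1 rmorph1 mul1r.
- move=> r; rewrite mulrN mulNr -(mulrA _ P) Xplus_iota Sσ !mulrA.
  by rewrite -!rmorphM cSp.
- move=> r; rewrite mulrN mulNr -(mulrA _ M) Xminus_iota Sτ !mulrA.
  by rewrite -!rmorphM cSm.
(* Both sides reduce to multiples of [S ym * S yp]: the scalars from moving these past the variables
   turn into [ξ] and 1, and the constant term [h] cancels against [S h]. *)
- rewrite !mulrNN antipode_ah antipodeM !mulrA.
  rewrite -(mulrA _ M) -(mulrA _ P) Xplus_iota Xminus_iota.
  have ξ0 := axi_neq0 D.
  have σSp := lrmorphism_scaledV gp ξ0 σp.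
  have τSp := asigmaV_scaled (invr_neq0 ξ0) σSp.
  rewrite τSp (lrmorphism_scaledV gm ξ0 σm) invrK !linearZ /=.
  rewrite -!scalerAl -!scalerAr -!scalerAl scalerA mulfV // scale1r !mulrA.
  rewrite -!rmorphM -(mulrA _ P M) Xplus_Xminus mulrDr -rmorphM linearN /=.
  by rewrite [in RHS]cSp addrA addNr add0r -scalerAr mulrA.
Qed.

(** For a suitable [c] this automorphism inverts the square of the antipode. *)
Lemma ambiskew_scaling c : c != 0 -> exists T : {lrmorphism A -> A},
  [/\ forall r, T (ι r) = ι r, T P = c *: P & T M = c^-1 *: M].
Proof.
move=> c0; apply: ambiskew_lrmorphism => [r|r|].
- by rewrite -scalerAl Xplus_iota scalerAr.
- by rewrite -scalerAl Xminus_iota scalerAr.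
- by rewrite -!scalerAl -!scalerAr scalerA mulfV // scale1r [c^-1 *: _]scalerA
    mulVf // scale1r Xplus_Xminus.
Qed.

(** Applying [F] twice gives S(y) X y, because [S] is an involution, and X y = c y X. *)
Lemma skew_primitive_antipode_sq (F : {linear A -> A}) X y (T : R -> R) c :
  (forall r, F (ι r) = ι (S r)) -> (forall x y, F (x * y) = F y * F x) ->
  grouplike HR y -> F X = - (ι (S y) * X) ->
  (forall r, X * ι r = ι (T r) * X) -> T y = c *: y -> F (F X) = c *: X.
Proof.
move=> Fι FM gy FX XT Ty.
rewrite {1}FX linearN /= FM Fι antipodeK // FX mulNr opprK -mulrA XT Ty.
rewrite linearZ /= -scalerAl -scalerAr mulrA -rmorphM.
by rewrite grouplike_mulVr // rmorph1 mul1r.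
Qed.

Lemma bijective_of_sq (B : Type) (F T : B -> B) :
  (forall x, T (F (F x)) = x) -> (forall x, F (F (T x)) = x) -> bijective F.
Proof.
move=> TF FT; exists (T \o F) => x /=; first exact: TF.
by rewrite -[in LHS](FT x) TF FT.
Qed.

(** Each axiom is checked on constants, where it comes from [HR], and on X+ and X- by a common
    argument [hX]; it then passes to sums and products. *)
Lemma ambiskew_hopf : exists HA : hopf A,
  [/\ hopf_morphism HR HA ι,
      comul HA P = tens P 1 + tens (ι yp) P &
      comul HA M = tens M 1 + tens (ι ym) M].
Proof.
have [Δ [Δι ΔP ΔM]] := ambiskew_comul.
have [ε [ει εP εM]] := ambiskew_counit.
have [F [Fι FP FM Fmul]] := ambiskew_antipode.
have Δy y : grouplike HR y -> Δ (ι y) = tens (ι y) (ι y).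
  by move=> gy; rewrite Δι gy.2 tmapE //; lin.
have Δassoc a : tassoc (tmap Δ id (Δ a)) = tmap id Δ (Δ a).
  have hX X y : grouplike HR y -> Δ X = tens X 1 + tens (ι y) X ->
      tassoc (tmap Δ id (Δ X)) = tmap id Δ (Δ X).
    move=> gy ΔX; rewrite ΔX !tmapD; try lin.
    rewrite !tmapE; try lin.
    rewrite rmorph1 ΔX Δy // tassocD !tassocE tsumD; last by lin.
    by rewrite !tsumE ?tensDr ?addrA //; lin.
  elim/ambiskew_gen_ind: a => [r|||x y hx hy|x y hx hy].
  - rewrite Δι !tmap_tmap; try lin.
    rewrite [LHS](linear_tsum _ _ (@tassoc_linear k A A A)).
    transitivity (tsum (fun x y => tsum (fun u v =>
      tens (ι u) (tens (ι v) (ι y)) : tensor A (tensor A A)) (comul HR x))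
      (comul HR r)).
      apply: eq_tsum => x y; rewrite Δι tassocE tsum_tmap //; lin.
    rewrite comul_assoc; try lin.
    apply: eq_tsum => x y; rewrite Δι /tmap.
    by rewrite (linear_tsum (L := fun z => tens (ι x) z)) //; lin.
  - exact: hX gp ΔP.
  - exact: hX gm ΔM.
  - by rewrite raddfD !tmapD ?tassocD ?hx ?hy //; lin.
  - rewrite rmorphM !tmapM ?tassocM ?hx ?hy //; try lin; exact: rmorphM.
have counitl a : tsum (fun x y => (ε x : k) *: y) (Δ a) = a.
  have hb : bilin (fun x y : A => (ε x : k) *: y) by lin.
  have hX X y : grouplike HR y -> Δ X = tens X 1 + tens (ι y) X -> ε X = 0 ->
      tsum (fun x y => (ε x : k) *: y) (Δ X) = X.
    move=> gy ΔX εX; rewrite ΔX (tsumD hb) !tsumE // εX ει scale0r add0r.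
    by rewrite (grouplike_counit gy) scale1r.
  elim/ambiskew_gen_ind: a => [r|||x y hx hy|x y hx hy].
  - rewrite Δι tsum_tmap // -[in RHS](counitl HR r) (linear_tsum (L := ι));
      last by lin.
    by apply: eq_tsum => x y; rewrite ει linearZ.
  - exact: hX gp ΔP εP.
  - exact: hX gm ΔM εM.
  - by rewrite raddfD (tsumD hb) hx hy.
  - rewrite rmorphM -[in RHS]hx -[in RHS]hy; apply: (tsumM (mul_bilin A)) => //.
    by move=> u v u' v'; rewrite rmorphM -scalerAl -scalerAr scalerA.
have counitr a : tsum (fun x y => (ε y : k) *: x) (Δ a) = a.
  have hb : bilin (fun x y : A => (ε y : k) *: x) by lin.
  have hX X y : Δ X = tens X 1 + tens (ι y) X -> ε X = 0 ->
      tsum (fun x y => (ε y : k) *: x) (Δ X) = X.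
    move=> ΔX εX; rewrite ΔX (tsumD hb) !tsumE // εX scale0r addr0.
    by rewrite [ε 1]rmorph1 scale1r.
  elim/ambiskew_gen_ind: a => [r|||x y hx hy|x y hx hy].
  - rewrite Δι tsum_tmap // -[in RHS](counitr HR r) (linear_tsum (L := ι));
      last by lin.
    by apply: eq_tsum => x y; rewrite ει linearZ.
  - exact: hX ΔP εP.
  - exact: hX ΔM εM.
  - by rewrite raddfD (tsumD hb) hx hy.
  - rewrite rmorphM -[in RHS]hx -[in RHS]hy; apply: (tsumM (mul_bilin A)) => //.
    by move=> u v u' v'; rewrite rmorphM -scalerAl -scalerAr scalerA.
have F1 : F 1 = 1 by rewrite -(rmorph1 ι) Fι antipode1.
have ε1 : ε 1 = 1 by rewrite rmorph1.
have antil a : tsum (fun x y => F x * y) (Δ a) = (ε a : k)%:A.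
  have hb : bilin (fun x y => F x * y) by lin.
  have hX X y : grouplike HR y -> Δ X = tens X 1 + tens (ι y) X -> ε X = 0 ->
      F X = - (ι (S y) * X) ->
      tsum (fun x y => F x * y) (Δ X) = (ε X : k)%:A.
    move=> gy ΔX εX FX; rewrite ΔX (tsumD hb) !tsumE // εX FX Fι mulr1.
    by rewrite addNr scale0r.
  elim/ambiskew_gen_ind: a => [r|||x y hx hy|x y hx hy].
  - rewrite Δι tsum_tmap // ει -(rmorph1 ι) -linearZ /= -(antipodel HR r).
    rewrite (linear_tsum (L := ι)); last by lin.
    by apply: eq_tsum => x y; rewrite rmorphM Fι.
  - exact: hX gp ΔP εP FP.
  - exact: hX gm ΔM εM FM.
  - by rewrite !raddfD (tsumD hb) hx hy scalerDl.
  - transitivity (tsum (fun u v => (ε x : k) *: (F u * v : A)) (Δ y));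
      last first.
      rewrite -(linear_tsum (L := fun z : A => (ε x : k) *: z)); last by lin.
      by rewrite hy scalerA rmorphM.
    (* As [F] reverses products, the parts of [x] stand between those of [y]; the sum over [x] must
       be innermost to collapse to its counit. *)
    rewrite rmorphM tsum_mul // exchange_tsum; apply: eq_tsum => u v.
    transitivity (F u * tsum (fun x y => F x * y) (Δ x) * v).
      rewrite (linear_tsum (L := fun z => F u * z * v)); last by lin.
      by apply: eq_tsum => x' y'; rewrite Fmul !mulrA.
    by rewrite hx mulr_algr -scalerAl.
have antir a : tsum (fun x y => x * F y) (Δ a) = (ε a : k)%:A.
  have hb : bilin (fun x y => x * F y) by lin.
  have hX X y : grouplike HR y -> Δ X = tens X 1 + tens (ι y) X -> ε X = 0 ->
      F X = - (ι (S y) * X) ->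
      tsum (fun x y => x * F y) (Δ X) = (ε X : k)%:A.
    move=> gy ΔX εX FX; rewrite ΔX (tsumD hb) !tsumE // εX FX F1 mulr1.
    rewrite mulrN mulrA -rmorphM grouplike_mulrV // rmorph1 mul1r addrN.
    by rewrite scale0r.
  elim/ambiskew_gen_ind: a => [r|||x y hx hy|x y hx hy].
  - rewrite Δι tsum_tmap // ει -(rmorph1 ι) -linearZ /= -(antipoder HR r).
    rewrite (linear_tsum (L := ι)); last by lin.
    by apply: eq_tsum => x y; rewrite rmorphM Fι.
  - exact: hX gp ΔP εP FP.
  - exact: hX gm ΔM εM FM.
  - by rewrite !raddfD (tsumD hb) hx hy scalerDl.
  - transitivity (tsum (fun u v => (ε y : k) *: (u * F v : A)) (Δ x));
      last first.
      rewrite -(linear_tsum (L := fun z : A => (ε y : k) *: z)); last by lin.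
      by rewrite hx scalerA rmorphM mulrC.
    rewrite rmorphM tsum_mul //; apply: eq_tsum => u v.
    transitivity (u * tsum (fun x y => x * F y) (Δ y) * F v).
      rewrite (linear_tsum (L := fun z => u * z * F v)); last by lin.
      by apply: eq_tsum => x' y'; rewrite Fmul !mulrA.
    by rewrite hy mulr_algr -scalerAl.
have Fbij : bijective F.
  (* The square of [F] multiplies X+ by [ξ] and X- by its inverse, so the rescaling by the inverse
     of [ξ] undoes it. *)
  have [T [Tι TP TM]] := ambiskew_scaling (invr_neq0 (axi_neq0 D)).
  have FFP := skew_primitive_antipode_sq Fι Fmul gp FP (@Xplus_iota _ _ D) σp.
  have FFM := skew_primitive_antipode_sq Fι Fmul gm FM (@Xminus_iota _ _ D)
    (asigmaV_scaled (axi_neq0 D) σm).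
  apply: (@bijective_of_sq _ F T) => x.
    elim/ambiskew_gen_ind: x => [r|||x y hx hy|x y hx hy].
    - by rewrite !Fι antipodeK.
    - by rewrite FFP linearZ /= TP scalerA mulfV ?axi_neq0 // scale1r.
    - rewrite FFM linearZ /= TM scalerA.
      by rewrite mulfV ?invr_neq0 ?axi_neq0 // scale1r.
    - by rewrite !linearD /= hx hy.
    - by rewrite !Fmul rmorphM /= hx hy.
  elim/ambiskew_gen_ind: x => [r|||x y hx hy|x y hx hy].
  - by rewrite Tι !Fι antipodeK.
  - by rewrite TP !linearZ /= FFP scalerA mulVf ?axi_neq0 // scale1r.
  - by rewrite TM !linearZ /= FFM scalerA invrK mulfV ?axi_neq0 // scale1r.
  - by rewrite !linearD /= hx hy.
  - by rewrite rmorphM !Fmul hx hy.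
exists (Hopf Δassoc counitl counitr antil antir Fbij); split=> //; split=> //.
Qed.

End HopfStructure.

(** * The data of the theorem *)

Section WindingAutomorphism.
Variables (k : fieldType) (R : algType k) (HR : hopf R).
Hypothesis Hc : cocommutative HR.
Variable χ : {lrmorphism R -> k^o}.
Local Notation S := (antipode HR).
Local Notation Δ := (comul HR).

Lemma tau_l_grouplike g : grouplike HR g -> tau_l HR χ g = (χ g : k) *: g.
Proof. by move=> [_ hg]; rewrite /tau_l hg tsumE //; lin. Qed.

Lemma character_grouplike_neq0 g : grouplike HR g -> (χ g : k) != 0.
Proof.
move=> hg; apply/eqP => χ0; have := congr1 χ (grouplike_mulrV hg).
rewrite rmorphM rmorph1 /= χ0 mul0r => /eqP.
by rewrite eq_sym oner_eq0.
Qed.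

(** This is the winding map of the character [χ \o S], the convolution inverse of [χ]. *)
Definition tau_lV (a : R) : R := tsum (fun x y => (χ (S x) : k) *: y) (Δ a).

(** By coassociativity the scalars χ(S(a_1)) and χ(a_2) meet, and their product sums to a counit. *)
Lemma sum_antipode_tau_l a :
  tsum (fun x y => (χ (S x) : k) *: tau_l HR χ y) (Δ a) = a.
Proof.
rewrite -[RHS](counitl HR).
transitivity (tsum (fun x y => tsum (fun x1 x2 =>
    (χ (S x1) * χ x2 : k) *: y) (Δ x)) (Δ a)).
  rewrite (comul_assoc HR (f := fun x1 x2 y => (χ (S x1) * χ x2 : k) *: y)).
  - apply: eq_tsum => x y.
    rewrite /tau_l (linear_tsum (L := fun z => (χ (S x) : k) *: z));
      last by lin.
    by apply: eq_tsum => u v; rewrite scalerA.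
  - move=> y z c u v; rewrite linearP [χ _]linearP mulrDl scalerDl -scalerAl.
    by congr (_ + _); apply/esym/scalerA.
  - move=> y z c u v; rewrite [χ (_ + _)]linearP mulrDr scalerDl -scalerAr.
    by congr (_ + _); apply/esym/scalerA.
  - by lin.
apply: eq_tsum => x y; under eq_tsum => u v do rewrite -[χ _ * χ _]rmorphM.
rewrite -(linear_tsum (L := fun z => (χ z : k) *: y)); last by lin.
by rewrite antipodel linearZ /= rmorph1 [_ *: 1]mulr1.
Qed.

Lemma tau_lK : cancel (tau_l HR χ) tau_lV.
Proof.
move=> a; rewrite /tau_lV (winding_sumr Hc a (winding_tau HR χ)); last by lin.
exact: sum_antipode_tau_l.
Qed.

Lemma tau_lVK : cancel tau_lV (tau_l HR χ).
Proof.
move=> a; rewrite /tau_lV (linear_tsum _ _ (winding_tau HR χ).1).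
rewrite -[RHS]sum_antipode_tau_l; apply: eq_tsum => x y.
by rewrite (GRing.scalable_linear (winding_tau HR χ).1).
Qed.

Lemma tau_l_lrmorphism : exists T : {lrmorphism R -> R}, T =1 tau_l HR χ.
Proof.
have hm : monoid_morphism (tau_l HR χ).
  by split; [exact: tau_l1 | exact: tau_lM].
by exists (HB.pack_for {lrmorphism R -> R} (tau_l HR χ)
  (GRing.isLinear.Build k R R _ _ (winding_tau HR χ).1)
  (GRing.isMonoidMorphism.Build R R _ hm)).
Qed.

(** Both admissible forms of [h] satisfy the single condition Δ h = h (x) 1 + z (x) h required by
    the construction. *)
Lemma hopf_ambiskew_of_data (z yp ym h : R) (D : ambiskew_data R) :
  hopf_ambiskew_choice HR χ z yp ym h ->
  asigma D =1 tau_l HR χ -> ah D = h -> axi D = χ yp ->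
  exists HA : hopf (ambiskew D), hopf_ambiskew HR χ yp ym h HA.
Proof.
move=> [[gz gp gm] [cz cp cm] [zE χE] ch hh] σE hE ξE.
have σw : winding HR (asigma D).
  by split=> [c x y|a]; rewrite ?linearP // σE -(winding_tau HR χ).2;
     apply: eq_tsum => x y; rewrite σE.
have σp : asigma D yp = axi D *: yp by rewrite σE tau_l_grouplike // ξE.
have σm : asigma D ym = axi D *: ym by rewrite σE tau_l_grouplike // ξE χE.
have hD : comul HR (ah D) = tens (ah D) 1 + tens (yp * ym) (ah D).
  rewrite hE -zE; case: hh => [[c ->]|[hP z1]]; last by rewrite hP z1.
  rewrite linearZ /= tensZl tensZr -scalerDr; congr (_ *: _).
  rewrite raddfB /= rmorph1 gz.2.
  (* This decomposition shows that z - 1 is itself skew primitive. *)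
  have -> : tens z z = tens z (z - 1) + tens (z - 1) 1 + 1 :> tensor R R.
    rewrite -addrA -[X in _ + (_ + X)]/(tens 1 1).
    by rewrite -tensDl subrK -tensDr subrK.
  by rewrite addrK addrC.
have [HA [Hι HP HM]] := ambiskew_hopf Hc σw gp gm cp cm σp σm hD.
by exists HA.
Qed.

Lemma winding_ambiskew_data (h : R) (c : k) : central h -> c != 0 ->
  exists D : ambiskew_data R,
    [/\ asigma D =1 tau_l HR χ, ah D = h & axi D = c].
Proof.
move=> ch c0; have [T TE] := tau_l_lrmorphism.
have TK : cancel T tau_lV by move=> x; rewrite TE tau_lK.
have TVK : cancel tau_lV T by move=> x; rewrite TE tau_lVK.
by exists (AmbiskewData TK TVK ch c0).
Qed.

End WindingAutomorphism.

(** * Linear functionals from Zorn's lemma; symmetric pure tensors *)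

Section LinearFunctional.
Import boolp classical_sets.
Variables (k : fieldType) (V : lmodType k).
Local Open Scope classical_set_scope.

Definition subspace (W : set V) : Prop :=
  W 0 /\ forall c x y, W x -> W y -> W (c *: x + y).

(** Take a maximal subspace [W] not containing [v]. Then [V] is the direct sum of [W] and the line
    of [v], and [φ] reads the coordinate along [v]. *)
Lemma exists_linear_functional (v : V) : v != 0 ->
  exists2 φ : V -> k^o, linear φ & φ v = 1.
Proof.
move=> v0; pose P W := subspace W /\ ~ W v.
(* The empty chain is excluded by asking only nonempty sets to be subspaces. *)
pose P' W := (exists x, W x) -> P W.
have [|W [P'W maxW]] := @Zorn_bigcup V P'.
  move=> F FP tot [x [X FX Xx]]; split; last first.
    by move=> [Y FY Yv]; have [_] := FP Y FY (ex_intro _ v Yv).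
  split; first by exists X => //; have [[]] := FP X FX (ex_intro _ x Xx).
  move=> c a b [A FA Aa] [B FB Bb].
  have [AB|BA] := tot A B FA FB.
    exists B => //; have [[_ h] _] := FP B FB (ex_intro _ b Bb).
    exact/h/Bb/AB.
  exists A => //; have [[_ h] _] := FP A FA (ex_intro _ a Aa).
  exact/h/BA.
have W0 : exists x, W x.
  (* An empty [W] would not be maximal, since the zero subspace avoids [v]. *)
  apply: contrapT => nW; apply: (maxW [set 0]).
    split=> [x Wx|/(_ 0 erefl) W0]; first by case: nW; exists x.
    by apply: nW; exists 0.
  move=> _; split; last by move=> /= v00; rewrite v00 eqxx in v0.
  by split=> //= c x y -> ->; rewrite scaler0 addr0.
have [[W00 Wl] Wv] := P'W W0.
have dec x : exists c : k, W (x - c *: v).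
  have [Wx|nWx] := pselect (W x); first by exists 0; rewrite scale0r subr0.
  (* The span of [W] and [x] is strictly larger than [W], so by maximality it contains [v]; solving
     for [x] gives the coefficient. *)
  pose B := [set y | exists w c, W w /\ y = w + c *: x].
  have Bl : subspace B.
    split; first by exists 0, 0; rewrite scale0r addr0.
    move=> c _ _ [w [a [Ww ->]]] [w' [a' [Ww' ->]]].
    exists (c *: w + w'), (c * a + a'); split; first exact: Wl.
    by rewrite scalerDr scalerDl scalerA addrACA.
  have Bv : B v.
    apply: contrapT => nBv; apply: (maxW B); last by split.
    split=> [w Ww|BW]; first by exists w, 0; rewrite scale0r addr0.
    by apply/nWx/BW; exists 0, 1; rewrite scale1r add0r.
  have [w [c [Ww vE]]] := Bv.
  have c0 : c != 0.
    by apply/eqP => c0; apply: Wv; rewrite vE c0 scale0r addr0.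
  exists c^-1; rewrite vE scalerDr scalerA mulVf // scale1r.
  by rewrite opprD addrCA subrr addr0 -scaleNr -[_ *: _]addr0;
    apply: Wl.
have uniq c d x : W (x - c *: v) -> W (x - d *: v) -> c = d.
  move=> Wc Wd; apply/eqP; rewrite -subr_eq0; apply/negPn/negP => cd.
  apply: Wv; have W1 := Wl (-1) _ _ Wc Wd.
  have /(Wl (c - d)^-1 _ 0) := W1; move/(_ W00).
  have -> : -1 *: (x - c *: v) + (x - d *: v) = (c - d) *: v.
    by rewrite scaleN1r opprB addrA subrK scalerBl.
  by rewrite scalerA mulVf // scale1r addr0.
pose φ x := projT1 (cid (dec x)).
have φP x : W (x - φ x *: v) by rewrite /φ; case: cid.
exists φ => [c x y|].
  apply: (uniq _ _ (c *: x + y)) (φP _) _.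
  have := Wl c _ _ (φP x) (φP y).
  by rewrite scalerBr addrACA -opprD scalerA -scalerDl.
apply: (uniq _ _ v) (φP v) _.
by rewrite scale1r subrr.
Qed.

(** A functional with φ(v) = 1, applied to the right factor, turns the equality into u = φ(u) v. *)
Lemma tens_comm_proportional (u v : V) :
  tens u v = tens v u -> v != 0 -> exists c : k, u = c *: v.
Proof.
move=> uv v0; have [φ φl φv] := exists_linear_functional v0.
have hb : bilin (fun x y : V => (φ y : k) *: x) by lin.
have := congr1 (tsum (fun x y => (φ y : k) *: x)) uv.
by rewrite !tsumE // φv scale1r => ->; exists (φ u).
Qed.

End LinearFunctional.

Lemma cocommutative_skew_primitive (k : fieldType) (R : algType k)
    (HR : hopf R) (z h : R) :
  cocommutative HR -> comul HR h = tens h 1 + tens z h ->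
  (exists c : k, h = c *: (z - 1)) \/ (primitive HR h /\ z = 1).
Proof.
move=> Hc Δh; have [z1|z1] := eqVneq z 1.
  by right; split=> //; rewrite /primitive Δh z1.
left; apply: tens_comm_proportional; last by rewrite subr_eq0.
have := Hc h; rewrite Δh /tswap tsumD; last by lin.
rewrite !tsumE; try lin.
move=> swap; rewrite tensBl tensBr; apply/eqP.
by rewrite subr_eq addrAC eq_sym subr_eq addrC -swap addrC.
Qed.

(** * Coordinates in the monomials X-^i X+^j *)

Section RegularRepresentation.
Variables (k : fieldType) (R : algType k) (D : ambiskew_data R).
Local Notation A := (ambiskew D).
Local Notation ι := (iota_R D).
Local Notation P := (Xplus D).
Local Notation M := (Xminus D).
Local Notation σ := (asigma D).
Local Notation τ := (asigmaV D).
Local Notation ξ := (axi D).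

(* The left regular representation: f stands for the sum of the
   X-^i (f i j) X+^j. *)
Fixpoint regular (s : aterm R) (f : nat -> nat -> R) (i j : nat) : R :=
  match s with
  | AConst r => iter i σ r * f i j
  | AXplus => ξ ^+ i *: (if j is l.+1 then σ (f i l) else 0)
              + verma_coef D i.+1 * f i.+1 j
  | AXminus => if i is l.+1 then f l j else 0
  | AAdd s t => regular s f i j + regular t f i j
  | AMul s t => regular s (regular t f) i j
  | AScale c s => c *: regular s f i j
  end.

Lemma regular_ext s f g : f =2 g -> regular s f =2 regular s g.
Proof.
elim: s f g => [r|||||] //=.
- by move=> f g e i j; rewrite e.
- by move=> f g e i [|j]; rewrite !e.
- by move=> f g e [|i] j.
- by move=> s IHs t IHt f g e i j; rewrite (IHs _ _ e) (IHt _ _ e).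
- by move=> s IHs t IHt f g e; apply/IHs/IHt.
- by move=> c s IH f g e i j; rewrite (IH _ _ e).
Qed.

Lemma regularD s f g i j :
  regular s (fun l m => f l m + g l m) i j = regular s f i j + regular s g i j.
Proof.
elim: s f g i j => [r|||||] //=.
- by move=> f g i j; rewrite mulrDr.
- move=> f g i [|j]; rewrite mulrDr; first by rewrite !scaler0 !add0r.
  by rewrite rmorphD scalerDr addrACA.
- by move=> f g [|i] j; rewrite ?addr0.
- by move=> s IHs t IHt f g i j; rewrite IHs IHt addrACA.
- move=> s IHs t IHt f g i j; rewrite -IHs.
  by apply: regular_ext => l m; apply: IHt.
- by move=> c s IH f g i j; rewrite IH scalerDr.
Qed.

Lemma regularZ s c f i j :
  regular s (fun l m => c *: f l m) i j = c *: regular s f i j.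
Proof.
elim: s f i j => [r|||||] //=.
- by move=> f i j; rewrite scalerAr.
- move=> f i [|j]; rewrite scalerDr scalerAr; first by rewrite !scaler0.
  by rewrite linearZ /= !scalerA [c * _]mulrC.
- by move=> f [|i] j; rewrite ?scaler0.
- by move=> s IHs t IHt f i j; rewrite IHs IHt scalerDr.
- move=> s IHs t IHt f i j; rewrite -IHs.
  by apply: regular_ext => l m; apply: IHt.
- by move=> a s IH f i j; rewrite IH !scalerA mulrC.
Qed.

(** The action of X+ encodes X+ X-^n = ξ^n X-^n X+ + X-^(n-1) v_n, where v_n is [verma_coef D n];
    the recursion defining v_n is what the relation for X+ X- demands. *)
Lemma regular_eq s t : aterm_eq D s t -> forall f, regular s f =2 regular t f.
Proof.
elim=> {s t} //=.
- by move=> s t _ IH f i j; rewrite IH.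
- by move=> s t u _ IH1 _ IH2 f i j; rewrite IH1 IH2.
- by move=> s s' t t' _ IH1 _ IH2 f i j; rewrite IH1 IH2.
- move=> s s' t t' _ IH1 _ IH2 f i j.
  by rewrite IH1; apply: regular_ext => l m; rewrite IH2.
- by move=> c s s' _ IH f i j; rewrite IH.
- by move=> s t u f i j; rewrite addrA.
- by move=> s t f i j; rewrite addrC.
- by move=> s f i j; rewrite iter_asigma0 mul0r add0r.
- by move=> s f i j; rewrite scaleN1r addNr iter_asigma0 mul0r.
- by move=> s f i j; rewrite iter_asigma1 mul1r.
- by move=> s f; apply: regular_ext => i j; rewrite iter_asigma1 mul1r.
- by move=> s t u f i j; rewrite regularD.
- by move=> a b s f i j; rewrite scalerA.
- by move=> s f i j; rewrite scale1r.
- by move=> c s t f i j; rewrite scalerDr.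
- by move=> a b s f i j; rewrite scalerDl.
- by move=> c s t f i j; rewrite regularZ.
- by move=> r s f i j; rewrite iter_asigmaD mulrDl.
- by move=> r s f i j; rewrite iter_asigmaM mulrA.
- by move=> c r f i j; rewrite iter_asigmaZ scalerAl.
- move=> r f i j; rewrite -iterSr /= mulrDr; congr (_ + _).
    by case: j => [|j]; rewrite ?scaler0 ?mulr0 // rmorphM -scalerAr.
  by rewrite !mulrA; congr (_ * _); rewrite (verma_coef_central D i.+1).
- by move=> r f [|i] j /=; rewrite ?mulr0 // -iterS iterSr asigmaVK.
- move=> f [|i] j /=.
    by case: j => [|j]; rewrite ?rmorph0 !scaler0 ?add0r !addr0.
  rewrite mulrDl -scalerAl scalerDr addrCA scalerA -exprS; congr (_ + _).
Qed.

Definition basis1 (i j : nat) : R := ((i == 0%N) && (j == 0%N))%:R.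

(** Acting on [basis1], the coordinates of 1, gives coefficients placed between X-^i and X+^j; the
    iterate of [τ] moves them to the left of X-^i. *)
Definition coef (i j : nat) (x : A) : R :=
  iter i τ (regular (ambiskew_repr x) basis1 i j).

Lemma coefE i j s : coef i j (ambiskew_of D s) =
  iter i τ (regular s basis1 i j).
Proof. by congr (iter _ _ _); apply/regular_eq/ambiskew_repr_of. Qed.

Lemma asigmaV_linear : linear τ.
Proof.
move=> c x y; apply: (can_inj (@asigmaK _ _ D)).
by rewrite linearP /= !asigmaVK.
Qed.

Lemma iter_asigmaV_linear i : linear (iter i τ).
Proof. by elim: i => //= i IH c x y /=; rewrite IH asigmaV_linear. Qed.

Lemma coef_linear i j : linear (coef i j).
Proof.
move=> c; elim/ambiskewW=> s; elim/ambiskewW=> t.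
by rewrite -ambiskew_of_scale -ambiskew_of_add !coefE /= iter_asigmaV_linear.
Qed.

Lemma iter_asigmaVK i a : iter i τ (iter i σ a) = a.
Proof. by elim: i a => //= i IH a; rewrite -iterS iterSr asigmaK. Qed.

Lemma iter_asigmaV0 i : iter i τ 0 = 0.
Proof. by rewrite -[in LHS](iter_asigma0 D i) iter_asigmaVK. Qed.

Lemma coef_monomial (X : aterm R) i0 j0 :
  (forall i j, regular X basis1 i j = ((i == i0) && (j == j0))%:R) ->
  forall i j a, coef i j (ι a * ambiskew_of D X) =
    if (i == i0) && (j == j0) then a else 0.
Proof.
move=> hX i j a; rewrite -ambiskew_of_mul coefE /= hX.
by case: ifP => _; rewrite ?mulr1 ?mulr0 ?iter_asigmaVK ?iter_asigmaV0.
Qed.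

Lemma coef_iota i j a :
  coef i j (ι a) = if (i == 0%N) && (j == 0%N) then a else 0.
Proof.
rewrite -[ι a]mulr1; apply: (@coef_monomial (AConst 1)) => l m.
by rewrite /= iter_asigma1 mul1r.
Qed.

Lemma coef_Xplus i j a :
  coef i j (ι a * P) = if (i == 0%N) && (j == 1%N) then a else 0.
Proof.
apply: coef_monomial => l m /=; rewrite mulr0 addr0.
by case: m l => [|m] [|l] /=; 
  rewrite ?scaler0 ?rmorph0 ?scaler0 ?expr0 ?scale1r ?rmorph_nat.
Qed.

Lemma coef_Xminus i j a :
  coef i j (ι a * M) = if (i == 1%N) && (j == 0%N) then a else 0.
Proof. by apply: coef_monomial => -[|[|l]] [|m]. Qed.

Lemma coef_XminusXplus i j a :
  coef i j (ι a * (M * P)) = if (i == 1%N) && (j == 1%N) then a else 0.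
Proof.
have -> : M * P = ambiskew_of D (AMul (AXminus _) (AXplus _)).
  by rewrite ambiskew_of_mul.
apply: coef_monomial => -[|l] m //=.
rewrite mulr0 addr0.
by case: m l => [|m] [|l] /=; 
  rewrite ?scaler0 ?rmorph0 ?scaler0 ?expr0 ?scale1r ?rmorph_nat.
Qed.

End RegularRepresentation.

(** * The converse *)

Section SkewPrimitiveConverse.
Variables (k : fieldType) (R A : algType k) (HR : hopf R) (HA : hopf A).
Variable ι : {lrmorphism R -> A}.
Hypothesis Hι : hopf_morphism HR HA ι.
Variables (π c : A -> R) (X : A).
Hypothesis πl : linear π.
Hypothesis cl : linear c.
Hypothesis πι : forall r, π (ι r) = r.
Hypothesis cι : forall r, c (ι r) = 0.
Hypothesis cX : forall r, c (ι r * X) = r.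
Hypothesis πX : forall r, π (ι r * X) = 0.

Local Notation ε := (counit HR).

Let cX1 : c X = 1. Proof. by rewrite -(mul1r X) -(rmorph1 ι) cX. Qed.
Let πX1 : π X = 0. Proof. by rewrite -(mul1r X) -(rmorph1 ι) πX. Qed.

Let Δι a : comul HA (ι a) = tmap ι ι (comul HR a).
Proof. by case: Hι. Qed.
Let ει a : counit HA (ι a) = ε a. Proof. by case: Hι. Qed.

Lemma tmap_retraction t : tmap π π (tmap ι ι t) = t.
Proof.
rewrite tmap_tmap // -[RHS]tsum_tens; apply: eq_tsum => x y.
by rewrite !πι.
Qed.

Section TwoSided.
Variables l r : R.
Hypothesis ΔX : comul HA X = tens X (ι r) + tens (ι l) X.

(** Coassociativity at [X] compares X (x) r (x) r with X (x) Δ(r), and Δ(l) (x) X with l (x) l (x)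
    X; the counit axioms then give the counits. *)
Lemma skew_primitive_grouplike :
  [/\ grouplike HR r, grouplike HR l & counit HA X = 0].
Proof.
have sumR (f : A -> A -> tensor R R) :
    bilin f -> (forall x y, f (ι x) (ι y) = 0) ->
    forall a, tsum f (comul HA (ι a)) = 0.
  move=> fb f0 a; rewrite Δι tsum_tmap //.
  exact: tsum_eq0.
have ε1 : ε 1 = 1 by rewrite rmorph1.
have ε0 : ε 0 = 0 by rewrite raddf0.
have sumΔ a : tsum (fun x y => tens (π x) (π y)) (comul HA (ι a)) = comul HR a.
  by rewrite Δι; apply: tmap_retraction.
have hπ : bilin (fun x y => tens (π x) (π y)) by lin.
have Δr : comul HR r = tens r r.
  (* Extracts the terms with [X] in the first place; the others vanish because [c] kills [R]. *)
  pose f x y z := (ε (c x) : k) *: tens (π y) (π z).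
  have fl x : bilin (f x) by rewrite /f; lin.
  have f0 a y z : f (ι a) y z = 0 by rewrite /f cι ε0 scale0r.
  have fX y z : f X y z = tens (π y) (π z) by rewrite /f cX1 ε1 scale1r.
  have : tsum (fun x y => tsum (fun x1 x2 => f x1 x2 y) (comul HA x))
      (comul HA X) =
    tsum (fun x y => tsum (fun y1 y2 => f x y1 y2) (comul HA y)) (comul HA X).
    by apply: comul_assoc; rewrite /f; lin.
  have b1 : bilin (fun x y => tsum (fun x1 x2 => f x1 x2 y) (comul HA x)).
    by rewrite /f; lin.
  have b2 : bilin (fun x y => tsum (fun y1 y2 => f x y1 y2) (comul HA y)).
    by rewrite /f; lin.
  rewrite ΔX (tsumD b1) (tsumD b2) !tsumE //.
  rewrite (sumR (fun x1 x2 => f x1 x2 X)) //; last by rewrite /f; lin.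
  have -> : tsum (fun y1 y2 => f (ι l) y1 y2) (comul HA X) = 0.
    by apply: tsum_eq0 => *; apply: f0.
  rewrite ΔX tsumD; last by rewrite /f; lin.
  rewrite !tsumE; try by rewrite /f; lin.
  rewrite fX f0 !πι !addr0 => ->; rewrite -sumΔ; apply: eq_tsum => x y.
  exact/esym/fX.
have Δl : comul HR l = tens l l.
  (* Extracts the terms with [X] in the third place. *)
  pose f x y z := (ε (c z) : k) *: tens (π x) (π y).
  have f0 a x y : f x y (ι a) = 0 by rewrite /f cι ε0 scale0r.
  have fX x y : f x y X = tens (π x) (π y) by rewrite /f cX1 ε1 scale1r.
  have : tsum (fun x y => tsum (fun x1 x2 => f x1 x2 y) (comul HA x))
      (comul HA X) =
    tsum (fun x y => tsum (fun y1 y2 => f x y1 y2) (comul HA y)) (comul HA X).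
    by apply: comul_assoc; rewrite /f; lin.
  have b1 : bilin (fun x y => tsum (fun x1 x2 => f x1 x2 y) (comul HA x)).
    by rewrite /f; lin.
  have b2 : bilin (fun x y => tsum (fun y1 y2 => f x y1 y2) (comul HA y)).
    by rewrite /f; lin.
  rewrite ΔX (tsumD b1) (tsumD b2) !tsumE //.
  rewrite [X in _ = X + _](sumR (fun y1 y2 => f X y1 y2)) //;
    last by rewrite /f; lin.
  have -> : tsum (fun x1 x2 => f x1 x2 (ι r)) (comul HA X) = 0.
    by apply: tsum_eq0 => *; apply: f0.
  rewrite ΔX tsumD; last by rewrite /f; lin.
  rewrite [in RHS]tsumE; last by rewrite /f; lin.
  rewrite [in RHS]tsumE; last by rewrite /f; lin.
  rewrite fX f0 !πι !add0r => <-; rewrite -sumΔ; apply: eq_tsum => x y.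
  exact/esym/fX.
have bl : bilin (fun x y : A => (counit HA x : k) *: y) by lin.
have br : bilin (fun x y : A => (counit HA y : k) *: x) by lin.
have cZ a x : c (a *: x) = a *: c x by exact: (GRing.scalable_linear cl).
have πZ a x : π (a *: x) = a *: π x by exact: (GRing.scalable_linear πl).
have := counitl HA X; rewrite ΔX (tsumD bl) !tsumE // ει => EX.
have := counitr HA X; rewrite ΔX (tsumD br) !tsumE // ει => EX'.
have εl : ε l = 1.
  have := congr1 (fun x => ε (c x)) EX; rewrite cl cι scaler0 add0r cZ cX1.
  by rewrite linearZ /= ε1 => <-; rewrite [RHS]mulr1.
have εr : ε r = 1.
  have := congr1 (fun x => ε (c x)) EX'; rewrite cl cZ cι scaler0 addr0 cX1.
  by rewrite linearZ /= ε1 => <-; rewrite [RHS]mulr1.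
have gr := grouplike_of_counit Δr εr.
split=> //; first exact: grouplike_of_counit.
(* The coordinate along 1 of the counit axiom is ε(X) r = 0, and [r] is nonzero. *)
have := congr1 π EX; rewrite πl πZ πX1 πι scaler0 addr0 => /eqP.
by rewrite scaler_eq0 (negPf gr.1) orbF => /eqP.
Qed.

End TwoSided.

Section OneSided.
Hypothesis Hc : cocommutative HR.
Variables (y : R) (θ : {lrmorphism R -> R}) (θV : R -> R).
Hypothesis ΔX : comul HA X = tens X 1 + tens (ι y) X.
Hypothesis Xι : forall a, X * ι a = ι (θ a) * X.
Hypothesis θVK : cancel θV θ.

Let Δcomm a : (tens X 1 + tens (ι y) X) * tmap ι ι (comul HR a) =
  tmap ι ι (comul HR (θ a)) * (tens X 1 + tens (ι y) X).
Proof. by rewrite -ΔX -!Δι -!rmorphM Xι. Qed.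

Let Δcomm_sum a :
  tsum (fun u v => tens (ι (θ u) * X) (ι v)) (comul HR a) +
  tsum (fun u v => tens (ι (y * u)) (ι (θ v) * X)) (comul HR a) =
  tsum (fun u v => tens (ι u * X) (ι v)) (comul HR (θ a)) +
  tsum (fun u v => tens (ι (u * y)) (ι v * X)) (comul HR (θ a)).
Proof.
have := Δcomm a; rewrite mulrDl mulrDr /tmap.
rewrite (linear_tsum (L := fun z => tens X 1 * z)); last by lin.
rewrite (linear_tsum (L := fun z => tens (ι y) X * z)); last by lin.
rewrite (linear_tsum (L := fun z => z * tens X 1)); last by lin.
rewrite (linear_tsum (L := fun z => z * tens (ι y) X)); last by lin.
have e1 : (fun u v => tens X 1 * tens (ι u) (ι v) : tensor A A) =2
    (fun u v => tens (ι (θ u) * X) (ι v)).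
  by move=> u v; rewrite tensM mul1r Xι.
have e2 : (fun u v => tens (ι y) X * tens (ι u) (ι v) : tensor A A) =2
    (fun u v => tens (ι (y * u)) (ι (θ v) * X)).
  by move=> u v; rewrite tensM Xι rmorphM.
have e3 : (fun u v => tens (ι u) (ι v) * tens X 1 : tensor A A) =2
    (fun u v => tens (ι u * X) (ι v)).
  by move=> u v; rewrite tensM mulr1.
have e4 : (fun u v => tens (ι u) (ι v) * tens (ι y) X : tensor A A) =2
    (fun u v => tens (ι (u * y)) (ι v * X)).
  by move=> u v; rewrite tensM rmorphM.
by rewrite (eq_tsum _ e1) (eq_tsum _ e2) (eq_tsum _ e3) (eq_tsum _ e4).
Qed.

(** Applying [c] to the left factor and [π] to the right one keeps only the terms with [X] on the
    left, which form the winding identity. *)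
Lemma skew_primitive_winding : winding HR θ.
Proof.
split=> [|a]; first exact: linearP.
have hcπ : bilin (fun u v => tens (c u) (π v)) by lin.
have := congr1 (tmap c π) (Δcomm_sum a).
rewrite !(tmapD cl πl) /tmap !(linear_tsum _ _ (tsum_linear hcπ)).
have e1 z : tsum (fun u v => tsum (fun u v => tens (c u) (π v))
    (tens (ι (θ u) * X) (ι v))) z = tsum (fun u v => tens (θ u) v) z.
  by apply: eq_tsum => u v; rewrite tsumE // cX πι.
have e2 z : tsum (fun u v => tsum (fun u v => tens (c u) (π v))
    (tens (ι u * X) (ι v))) z = z.
  by rewrite -[RHS]tsum_tens; apply: eq_tsum => u v; rewrite tsumE // cX πι.
have e0 (f : R -> R -> A) (g : R -> R -> R) z :
    tsum (fun u v => tsum (fun u v => tens (c u) (π v))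
      (tens (ι (g u v)) (f u v))) z = 0.
  apply: tsum_eq0 => u v; rewrite tsumE // cι.
  by rewrite -(scale0r 0) tensZl scale0r.
by rewrite e1 e2 !e0 !addr0.
Qed.

(** The terms with [X] on the right, simplified by the winding property on the right factor, give y
    θ(a) = θ(a) y after the counit is applied; [θ] is surjective. *)
Lemma skew_primitive_central : central y.
Proof.
have hw := skew_primitive_winding.
have hπc : bilin (fun u v => tens (π u) (c v)) by lin.
suff comm a : y * θ a = θ a * y by move=> r; rewrite -(θVK r) comm.
have := congr1 (tmap π c) (Δcomm_sum a).
rewrite !(tmapD πl cl) /tmap !(linear_tsum _ _ (tsum_linear hπc)).
have e1 z : tsum (fun u v => tsum (fun u v => tens (π u) (c v))
    (tens (ι (y * u)) (ι (θ v) * X))) z =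
    tsum (fun u v => tens (y * u) (θ v)) z.
  by apply: eq_tsum => u v; rewrite tsumE // cX πι.
have e2 z : tsum (fun u v => tsum (fun u v => tens (π u) (c v))
    (tens (ι (u * y)) (ι v * X))) z = tsum (fun u v => tens (u * y) v) z.
  by apply: eq_tsum => u v; rewrite tsumE // cX πι.
have e0 (f g : R -> R -> R) z :
    tsum (fun u v => tsum (fun u v => tens (π u) (c v))
      (tens (ι (f u v) * X) (ι (g u v)))) z = 0.
  apply: tsum_eq0 => u v; rewrite tsumE // cι.
  by rewrite -(scale0r 0) tensZr scale0r.
rewrite e1 e2 !e0 !add0r.
rewrite -(winding_sumr Hc (f := fun u v => tens (y * u) v) a hw); last by lin.
move/(congr1 (tsum (fun u v => (ε v : k) *: u))).
have bε : bilin (fun u v : R => (ε v : k) *: u) by lin.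
rewrite !(linear_tsum _ _ (tsum_linear bε)).
have e3 (L : R -> R) : linear L ->
    tsum (fun u v => tsum (fun u v : R => (ε v : k) *: u) (tens (L u) v))
      (comul HR (θ a)) = L (θ a).
  move=> Ll; rewrite -[RHS](counit_sumr HR _ Ll).
  by apply: eq_tsum => u v; rewrite tsumE.
by rewrite (e3 (fun u => y * u)) ?(e3 (fun u => u * y)) //; lin.
Qed.

End OneSided.
End SkewPrimitiveConverse.

Section Coordinates.
Variables (k : fieldType) (R A : algType k) (ι : {lrmorphism R -> A}).

(* C i j is the coordinate along X-^i X+^j. *)
Definition coordinates (P M : A) (C : nat -> nat -> A -> R) : Prop :=
  (forall i j, linear (C i j)) /\
  forall i j a,
    [/\ C i j (ι a) = if (i == 0%N) && (j == 0%N) then a else 0,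
        C i j (ι a * P) = if (i == 0%N) && (j == 1%N) then a else 0,
        C i j (ι a * M) = if (i == 1%N) && (j == 0%N) then a else 0
      & C i j (ι a * (M * P)) = if (i == 1%N) && (j == 1%N) then a else 0].

(** Each monomial is multiplied by a unit on the left, so its coordinate is corrected on the right
    by the inverse unit. *)
Lemma coordinates_scale P M C u v w u' v' w' P' M' :
  coordinates P M C -> u * u' = 1 -> v * v' = 1 -> w * w' = 1 ->
  P' = ι u * P -> M' = ι v * M -> M' * P' = ι w * (M * P) ->
  exists C', coordinates P' M' C'.
Proof.
move=> [Cl HC] uu vv ww PE ME MPE.
pose g i j : R := if (i, j) == (0, 1)%N then u' else
  if (i, j) == (1, 0)%N then v' else if (i, j) == (1, 1)%N then w' else 1.
exists (fun i j x => C i j x * g i j); split=> [i j|i j a].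
  by have Cij := Cl i j; lin.
have [h1 _ _ _] := HC i j a.
have [_ h2 _ _] := HC i j (a * u).
have [_ _ h3 _] := HC i j (a * v).
have [_ _ _ h4] := HC i j (a * w).
rewrite MPE PE ME !mulrA -!rmorphM -[_ * M * P]mulrA h1 h2 h3 h4.
by case: i j {h1 h2 h3 h4} => [|[|i]] [|[|j]] /=;
  rewrite ?mul0r -?[a * _ * _]mulrA ?uu ?vv ?ww ?mulr1.
Qed.

End Coordinates.

Lemma coef_coordinates (k : fieldType) (R : algType k) (D : ambiskew_data R) :
  coordinates (iota_R D) (Xplus D) (Xminus D) (@coef k R D).
Proof.
split=> [i j|i j a]; first exact: coef_linear.
by rewrite coef_iota coef_Xplus coef_Xminus coef_XminusXplus.
Qed.

(** * Comultiplication of the relation between two skew primitive variables *)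

Section SkewPair.
Variables (k : fieldType) (R A : algType k) (HR : hopf R) (HA : hopf A).
Variable ι : {lrmorphism R -> A}.
Hypothesis Hι : hopf_morphism HR HA ι.
Variables (P M : A) (C : nat -> nat -> A -> R).
Hypothesis HC : coordinates ι P M C.
Variables (θp θm : R -> R) (yp ym h u : R) (c a b : k).
Hypothesis Pι : forall r, P * ι r = ι (θp r) * P.
Hypothesis Mι : forall r, M * ι r = ι (θm r) * M.
Hypothesis gp : grouplike HR yp.
Hypothesis gm : grouplike HR ym.
Hypothesis gu : grouplike HR u.
Hypothesis ΔP : comul HA P = tens P 1 + tens (ι yp) P.
Hypothesis ΔM : comul HA M = tens M 1 + tens (ι ym) M.
Hypothesis PM : P * M = ι h + c *: (ι u * (M * P)).
Hypothesis θpy : θp ym = a *: ym.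
Hypothesis θmy : θm yp = b *: yp.

Local Notation ε := (counit HR).

Lemma skew_pair_comul :
  tens (ι h) (ι 1) + c *: tens (ι u * (M * P)) (ι 1) +
  a *: tens (ι ym * P) (ι 1 * M) + tens (ι yp * M) (ι 1 * P) +
  tens (ι (yp * ym)) (ι h) + c *: tens (ι (yp * ym)) (ι u * (M * P)) =
  tmap ι ι (comul HR h) + c *: tens (ι u * (M * P)) (ι u) +
  (c * b) *: tens (ι (u * yp) * M) (ι u * P) +
  c *: tens (ι (u * ym) * P) (ι u * M) +
  c *: tens (ι (u * (ym * yp))) (ι u * (M * P)) :> tensor A A.
Proof.
have [Δι _ _] := Hι.
have := congr1 (comul HA) PM.
rewrite rmorphD /= linearZ /= !rmorphM /= !Δι ΔP ΔM gu.2 tmapE; try lin.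
rewrite !(mulrDl, mulrDr) !tensM !mul1r !mulr1 Pι Mι θpy θmy.
rewrite PM !linearZ /= -!scalerAl -!scalerAr !rmorph1 !mul1r.
rewrite !tensDl !tensDr !tensZl !tensZr !scalerDr.
rewrite !mulrA !scalerA !addrA.
exact.
Qed.

Let CI i j r : C i j (ι r) = if (i == 0%N) && (j == 0%N) then r else 0.
Proof. by case: (HC.2 i j r). Qed.
Let CP i j r : C i j (ι r * P) = if (i == 0%N) && (j == 1%N) then r else 0.
Proof. by case: (HC.2 i j r). Qed.
Let CM i j r : C i j (ι r * M) = if (i == 1%N) && (j == 0%N) then r else 0.
Proof. by case: (HC.2 i j r). Qed.
Let CMP i j r :
  C i j (ι r * (M * P)) = if (i == 1%N) && (j == 1%N) then r else 0.
Proof. by case: (HC.2 i j r). Qed.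

Lemma skew_pair_coordinates i j i' j' :
  let d (l m : nat) r : R := if (i == l) && (j == m) then r else 0 in
  let d' (l m : nat) r : R := if (i' == l) && (j' == m) then r else 0 in
  tens (d 0%N 0%N h) (d' 0%N 0%N 1) + c *: tens (d 1%N 1%N u) (d' 0%N 0%N 1) +
  a *: tens (d 0%N 1%N ym) (d' 1%N 0%N 1) + tens (d 1%N 0%N yp) (d' 0%N 1%N 1) +
  tens (d 0%N 0%N (yp * ym)) (d' 0%N 0%N h) +
  c *: tens (d 0%N 0%N (yp * ym)) (d' 1%N 1%N u) =
  tsum (fun x y => tens (d 0%N 0%N x) (d' 0%N 0%N y)) (comul HR h) +
  c *: tens (d 1%N 1%N u) (d' 0%N 0%N u) +
  (c * b) *: tens (d 1%N 0%N (u * yp)) (d' 0%N 1%N u) +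
  c *: tens (d 0%N 1%N (u * ym)) (d' 1%N 0%N u) +
  c *: tens (d 0%N 0%N (u * (ym * yp))) (d' 1%N 1%N u) :> tensor R R.
Proof.
move=> d d'; have := congr1 (tmap (C i j) (C i' j')) skew_pair_comul.
have Cl := HC.1 i j; have Cl' := HC.1 i' j'.
rewrite !(tmapD, tmapZ) // !tmapE // tmap_tmap // !(CI, CP, CM, CMP).
by move=> ->; do 4!congr (_ + _); apply: eq_tsum => x y; rewrite !CI.
Qed.

(** The extra grouplike [u] allows for a pair whose quadratic relation is not yet of ambiskew form;
    comparing coordinates of tensors forces it to be 1. *)
Lemma skew_pair_relations :
  [/\ u = 1, comul HR h = tens h 1 + tens (yp * ym) h, a = c & c * b = 1].
Proof.
have ε1 : ε 1 = 1 by rewrite rmorph1.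
have bε : bilin (fun x y : R => (ε x : k) *: y) by lin.
have t0 (t : tensor R R) : tsum (fun _ _ => 0 : tensor R R) t = 0.
  exact: tsum_eq0.
(* The coordinate along M (x) P says yp (x) 1 = c b (u yp (x) u), so c b u = 1 and the counit
   separates the scalar from [u]. *)
have := skew_pair_coordinates 1 0 0 1.
rewrite /= !(tens0l, tens0r, scaler0, addr0, add0r, t0).
move/(congr1 (tsum (fun x y : R => (ε x : k) *: y))).
rewrite tsumZ // !tsumE // [ε (u * yp)]rmorphM /=.
rewrite !grouplike_counit // mulr1 !scale1r => ucb.
have := congr1 ε ucb; rewrite linearZ /= ε1 grouplike_counit // [_ *: _]mulr1.
move=> cb; rewrite -cb scale1r in ucb.
(* The coordinate along P (x) M gives [a = c]; the one along 1 (x) 1, taken last, gives [Δ h]. *)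
have := skew_pair_coordinates 0 1 1 0.
rewrite /= !(tens0l, tens0r, scaler0, addr0, add0r, t0).
move/(congr1 (tsum (fun x y : R => (ε x : k) *: y))).
rewrite !tsumZ // !tsumE // -ucb mul1r !grouplike_counit // scale1r => ac.
have := congr1 ε ac; rewrite !linearZ /= ε1 ![_ *: _]mulr1 => {}ac.
have := skew_pair_coordinates 0 0 0 0.
by rewrite /= !(tens0l, tens0r, scaler0, addr0, add0r) tsum_tens => ->.
Qed.

End SkewPair.

Lemma conjugation_lrmorphism (k : fieldType) (R : algType k) (g g' : R) :
  two_sided_inverse g g' ->
  exists T : {lrmorphism R -> R}, forall x, T x = g' * x * g.
Proof.
move=> [gg' g'g]; pose T0 x := g' * x * g.
have Tl : linear T0 by rewrite /T0; lin.
have Tm : monoid_morphism T0.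
  split=> [|x y]; rewrite /T0 ?mulr1 //.
  by rewrite !mulrA -[_ * g * g']mulrA gg' mulr1.
by exists (HB.pack_for {lrmorphism R -> R} T0
  (GRing.isLinear.Build k R R _ _ Tl)
  (GRing.isMonoidMorphism.Build R R _ Tm)).
Qed.

Lemma asigmaV_lrmorphism (k : fieldType) (R : algType k) (D : ambiskew_data R) :
  exists T : {lrmorphism R -> R}, T =1 asigmaV D.
Proof.
have Tm : monoid_morphism (asigmaV D).
  split=> [|x y]; apply: (can_inj (@asigmaK _ _ D)).
    by rewrite rmorph1 asigmaVK.
  by rewrite rmorphM /= !asigmaVK.
by exists (HB.pack_for {lrmorphism R -> R} (asigmaV D)
  (GRing.isLinear.Build k R R _ _ (asigmaV_linear D))
  (GRing.isMonoidMorphism.Build R R _ Tm)).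
Qed.

Lemma central_mul (k : fieldType) (R : algType k) (x y : R) :
  central x -> central y -> central (x * y).
Proof. by move=> cx cy r; rewrite -mulrA cy mulrA cx -mulrA. Qed.

(** The comultiplication and the counit need checking on generators only, and the antipode then
    follows. *)
Lemma ambiskew_hopf_morphism (k : fieldType) (R A : algType k)
    (D : ambiskew_data R) (H : hopf (ambiskew D)) (HA : hopf A)
    (f : {lrmorphism ambiskew D -> A}) :
  let Q x := comul HA (f x) = tmap f f (comul H x) /\
             counit HA (f x) = counit H x in
  (forall r, Q (iota_R D r)) -> Q (Xplus D) -> Q (Xminus D) ->
  hopf_morphism H HA f.
Proof.
move=> Q Qι Qp Qm; have QA x : Q x.
  elim/ambiskew_gen_ind: x => // x y [Δx εx] [Δy εy]; split.
  - by rewrite !rmorphD /= tmapD ?Δx ?Δy //; lin.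
  - by rewrite !rmorphD /= εx εy.
  - by rewrite !rmorphM /= (tmap_lrmorphismM f) ?Δx ?Δy.
  - by rewrite !rmorphM /= εx εy.
by apply: antipode_morphism => a; case: (QA a).
Qed.

(** * Dividing a skew primitive variable by its grouplike [r] *)

Section NormalizeSkewPrimitive.
Variables (k : fieldType) (R A : algType k) (HR : hopf R) (HA : hopf A).
Hypothesis Hc : cocommutative HR.
Variable ι : {lrmorphism R -> A}.
Hypothesis Hι : hopf_morphism HR HA ι.
Variables (π c : A -> R) (X : A) (l r : R).
Variables (T : {lrmorphism R -> R}) (TV : R -> R).
Hypothesis πl : linear π.
Hypothesis cl : linear c.
Hypothesis πι : forall r, π (ι r) = r.
Hypothesis cι : forall r, c (ι r) = 0.
Hypothesis cX : forall r, c (ι r * X) = r.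
Hypothesis πX : forall r, π (ι r * X) = 0.
Hypothesis Xι : forall a, X * ι a = ι (T a) * X.
Hypothesis TVK : cancel TV T.
Hypothesis ΔX : comul HA X = tens X (ι r) + tens (ι l) X.
Local Notation S := (antipode HR).

(** The division makes the right grouplike equal to 1 and composes the automorphism with a
    conjugation by [r]; the one-sided results then apply to the new variable. *)
Lemma normalize_skew_primitive : exists θ : {lrmorphism R -> R},
  [/\ grouplike HR r /\ (forall x, θ x = T (S r * x * r)),
      forall a, X * ι (S r) * ι a = ι (θ a) * (X * ι (S r)),
      comul HA (X * ι (S r)) =
        tens (X * ι (S r)) 1 + tens (ι (l * S r)) (X * ι (S r)),
      winding HR θ & grouplike HR (l * S r) /\ central (l * S r)].
Proof.
have [gr gl _] := skew_primitive_grouplike Hι πl cl πι cι cX πX ΔX.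
have [rV Vr] := (grouplike_mulrV gr, grouplike_mulVr gr).
have [K KE] := conjugation_lrmorphism (conj rV Vr).
pose θ : {lrmorphism R -> R} := T \o K.
have θE x : θ x = T (S r * x * r) by rewrite /= KE.
have X1E : X * ι (S r) = ι (T (S r)) * X by rewrite Xι.
have X1ι a : X * ι (S r) * ι a = ι (θ a) * (X * ι (S r)).
  rewrite Xι [in RHS]mulrA -rmorphM θE -rmorphM -!mulrA rV mulr1.
  by rewrite Xι mulrA -!rmorphM.
have Δ1 : comul HA (X * ι (S r)) =
    tens (X * ι (S r)) 1 + tens (ι (l * S r)) (X * ι (S r)).
  have [Δι _ _] := Hι; have gV := grouplikeV gr.
  rewrite rmorphM /= Δι gV.2 tmapE; try lin.
  by rewrite ΔX mulrDl !tensM -!rmorphM rV rmorph1.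
(* The new variable is T(S r) X, so its coordinate is that of [X] times the inverse [T r]. *)
pose c1 x := c x * T r.
have c1l : linear c1 by rewrite /c1; lin.
have c1ι a : c1 (ι a) = 0 by rewrite /c1 cι mul0r.
have c1X a : c1 (ι a * (X * ι (S r))) = a.
  by rewrite /c1 X1E mulrA -rmorphM cX -mulrA -rmorphM Vr rmorph1 mulr1.
have θVK : cancel (fun x => r * TV x * S r) θ.
  by move=> x; rewrite θE !mulrA Vr mul1r -mulrA Vr mulr1 TVK.
exists θ; split=> //.
  exact: (skew_primitive_winding Hι πl c1l πι c1ι c1X (θ := θ) Δ1 X1ι).
split; first by apply: grouplikeM => //; apply: grouplikeV.
exact: (skew_primitive_central Hι πl c1l πι c1ι c1X Hc (θ := θ) Δ1 X1ι θVK).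
Qed.

End NormalizeSkewPrimitive.

Section CounitOfGenerators.
Variables (k : fieldType) (R : algType k) (HR : hopf R) (D : ambiskew_data R).
Variable H : hopf (ambiskew D).
Hypothesis Hι : hopf_morphism HR H (iota_R D).
Variables l r : R.

Lemma Xplus_counit :
  comul H (Xplus D) =
    tens (Xplus D) (iota_R D r) + tens (iota_R D l) (Xplus D) ->
  counit H (Xplus D) = 0.
Proof.
case/(skew_primitive_grouplike Hι (coef_linear 0 0) (coef_linear 0 1)) => // a.
- by rewrite coef_iota.
- by rewrite coef_iota.
- by rewrite coef_Xplus.
- by rewrite coef_Xplus.
Qed.

Lemma Xminus_counit :
  comul H (Xminus D) =
    tens (Xminus D) (iota_R D r) + tens (iota_R D l) (Xminus D) ->
  counit H (Xminus D) = 0.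
Proof.
case/(skew_primitive_grouplike Hι (coef_linear 0 0) (coef_linear 1 0)) => // a.
- by rewrite coef_iota.
- by rewrite coef_iota.
- by rewrite coef_Xminus.
- by rewrite coef_Xminus.
Qed.

End CounitOfGenerators.

(** * The normalized pair of variables and the isomorphism *)

Section Converse.
Variables (k : fieldType) (R : algType k) (HR : hopf R).
Hypothesis Hc : cocommutative HR.
Variables (D : ambiskew_data R) (HA : hopf (ambiskew D)) (lp rp lm rm : R).
Hypothesis Hι : hopf_morphism HR HA (iota_R D).
Hypothesis ΔP : comul HA (Xplus D) =
  tens (Xplus D) (iota_R D rp) + tens (iota_R D lp) (Xplus D).
Hypothesis ΔM : comul HA (Xminus D) =
  tens (Xminus D) (iota_R D rm) + tens (iota_R D lm) (Xminus D).

Local Notation A := (ambiskew D).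
Local Notation ι := (iota_R D).
Local Notation P := (Xplus D).
Local Notation M := (Xminus D).
Local Notation σ := (asigma D).
Local Notation τ := (asigmaV D).
Local Notation S := (antipode HR).
Local Notation ε := (counit HR).
Local Notation P1 := (P * ι (S rp)).
Local Notation M1 := (M * ι (S rm)).
Local Notation yp := (lp * S rp).
Local Notation ym := (lm * S rm).
Local Notation h1 := (ah D * (σ (S rp) * S rm)).

Lemma normalize_Xplus : exists θ : {lrmorphism R -> R},
  [/\ grouplike HR rp /\ (forall x, θ x = σ (S rp * x * rp)),
      forall a, P1 * ι a = ι (θ a) * P1,
      comul HA P1 = tens P1 1 + tens (ι yp) P1,
      winding HR θ & grouplike HR yp /\ central yp].
Proof.
apply: (normalize_skew_primitive Hc Hι (coef_linear 0 0) (coef_linear 0 1)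
  _ _ _ _ (@Xplus_iota _ _ D) (@asigmaVK _ _ D) ΔP) => a.
- by rewrite coef_iota.
- by rewrite coef_iota.
- by rewrite coef_Xplus.
- by rewrite coef_Xplus.
Qed.

Lemma normalize_Xminus : exists θ : {lrmorphism R -> R},
  [/\ grouplike HR rm /\ (forall x, θ x = τ (S rm * x * rm)),
      forall a, M1 * ι a = ι (θ a) * M1,
      comul HA M1 = tens M1 1 + tens (ι ym) M1,
      winding HR θ & grouplike HR ym /\ central ym].
Proof.
have [T TE] := asigmaV_lrmorphism D.
have [a|a|a|a|a||θ [[gr θE] Mι ΔM1 θw gy]] := normalize_skew_primitive Hc Hι
  (coef_linear 0 0) (coef_linear 1 0) _ _ _ _ _ (T := T) (TV := σ) _ ΔM.
- by rewrite coef_iota.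
- by rewrite coef_iota.
- by rewrite coef_Xminus.
- by rewrite coef_Xminus.
- by rewrite Xminus_iota TE.
- by move=> x; rewrite TE asigmaK.
by exists θ; split=> //; split=> // x; rewrite θE TE.
Qed.

Variables θp θm : {lrmorphism R -> R}.
Hypothesis gp : grouplike HR rp.
Hypothesis gm : grouplike HR rm.
Hypothesis θpE : forall x, θp x = σ (S rp * x * rp).
Hypothesis θmE : forall x, θm x = τ (S rm * x * rm).
Hypothesis P1ι : forall a, P1 * ι a = ι (θp a) * P1.
Hypothesis M1ι : forall a, M1 * ι a = ι (θm a) * M1.
Hypothesis ΔP1 : comul HA P1 = tens P1 1 + tens (ι yp) P1.
Hypothesis ΔM1 : comul HA M1 = tens M1 1 + tens (ι ym) M1.
Hypothesis wp : winding HR θp.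
Hypothesis wm : winding HR θm.
Hypothesis gyp : grouplike HR yp.
Hypothesis gym : grouplike HR ym.
Hypothesis cyp : central yp.
Hypothesis cym : central ym.

Let rpV : rp * S rp = 1 := grouplike_mulrV gp.
Let Vrp : S rp * rp = 1 := grouplike_mulVr gp.
Let rmV : rm * S rm = 1 := grouplike_mulrV gm.
Let Vrm : S rm * rm = 1 := grouplike_mulVr gm.

Lemma asigmaV_mul : {morph τ : x y / x * y}.
Proof.
by have [T TE] := asigmaV_lrmorphism D; move=> x y; rewrite -!TE rmorphM.
Qed.

Lemma asigmaV1 : τ 1 = 1.
Proof. by have [T TE] := asigmaV_lrmorphism D; rewrite -TE rmorph1. Qed.

(** Collecting the grouplikes on the right, P1 M1 is P M times [σ (S rp) * S rm], and M P is M1 P1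
    times [rp * τ rm]. *)
Lemma normalized_pair_relation (e := rp * τ rm * (σ (S rp) * S rm)) :
  P1 * M1 = ι h1 + axi D *: (M1 * P1 * ι e).
Proof.
have MP : M * P = M1 * P1 * ι (rp * τ rm).
  rewrite -!mulrA (mulrA (ι (S rm))) iota_Xplus -!mulrA -!rmorphM.
  by rewrite (mulrA (S rp)) Vrp mul1r -asigmaV_mul Vrm asigmaV1 rmorph1 mulr1.
have -> : M1 * P1 * ι e = M * P * ι (σ (S rp) * S rm).
  by rewrite /e [ι (rp * τ rm * _)]rmorphM mulrA -MP.
rewrite -!mulrA (mulrA (ι (S rp))) iota_Xminus -!mulrA -!rmorphM.
by rewrite (mulrA P) Xplus_Xminus mulrDl -scalerAl -rmorphM -[M * P * _]mulrA.
Qed.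

(** Moved to the left of the variables, [S rp] and [S rm] become units of [R], and
    [coordinates_scale] applies. *)
Lemma normalized_coordinates : exists C, coordinates ι P1 M1 C.
Proof.
apply: (coordinates_scale (coef_coordinates D) (u := σ (S rp)) (u' := σ rp)
  (v := τ (S rm)) (v' := τ rm)
  (w := τ (S rm * σ (S rp))) (w' := τ (σ rp * rm))).
- by rewrite -rmorphM Vrp rmorph1.
- by rewrite -asigmaV_mul Vrm asigmaV1.
- rewrite -asigmaV_mul -mulrA (mulrA (σ _)) -rmorphM Vrp rmorph1 mul1r Vrm.
  exact: asigmaV1.
- exact: Xplus_iota.
- exact: Xminus_iota.
- rewrite Xplus_iota -!mulrA (mulrA (ι (S rm))) -rmorphM (mulrA M).
  by rewrite Xminus_iota mulrA.
Qed.

(** The factor [e] of [normalized_pair_relation] is a scalar times the grouplike commutator [v] of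
    [rp] and [rm], so [skew_pair_relations] applies with [u = v]. *)
Lemma normalized_relations : exists c : k,
  [/\ P1 * M1 = ι h1 + c *: (M1 * P1), rp * rm = rm * rp,
      comul HR h1 = tens h1 1 + tens (yp * ym) h1,
      ε (θp ym) = c & c * (ε (θm yp) : k) = 1].
Proof.
have [C HC] := normalized_coordinates.
pose v := rp * rm * (S rp * S rm).
have gpV := grouplikeV gp; have gmV := grouplikeV gm.
have gv : grouplike HR v by do 2![apply: grouplikeM => //]; apply: grouplikeM.
have scaled (T : R -> R) g : winding HR T -> grouplike HR g ->
    exists c : k, T g = c *: g.
  by move=> Tw gg; exists (ε (T g)); apply: winding_grouplike.
(* Conjugation by [rm] fixes [rm], so [τ rm] is [θm rm], and a winding map rescales grouplikes;
   likewise for [σ (S rp)]. *)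
have [β Eβ] : exists β : k, τ rm = β *: rm.
  have [β Eβ] := scaled _ _ wm gm; exists β; rewrite -Eβ θmE.
  by rewrite Vrm mul1r.
have [α Eα] : exists α : k, σ (S rp) = α *: S rp.
  have [α Eα] := scaled _ _ wp gpV; exists α; rewrite -Eα θpE.
  by rewrite -mulrA Vrp mulr1.
have [γ Eγ] := scaled _ _ wp gv; have [δ Eδ] := scaled _ _ wm gv.
have [d Ed] : exists d : k, P1 * M1 = ι h1 + d *: (ι v * (M1 * P1)).
  have e_v : rp * τ rm * (σ (S rp) * S rm) = (α * β) *: v.
    rewrite Eα Eβ -!scalerAl -!scalerAr -!scalerAl scalerA mulrC.
    by [].
  exists (axi D * (α * β * γ * δ)); rewrite normalized_pair_relation e_v.
  congr (_ + _); rewrite -[RHS]scalerA; congr (_ *: _).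
  rewrite linearZ /= -scalerAr -[M1 * P1 * ι v]mulrA P1ι Eγ.
  rewrite [ι (γ *: _)]linearZ /=.
  rewrite -scalerAl -scalerAr (mulrA M1 (ι v)) M1ι Eδ.
  rewrite [ι (δ *: _)]linearZ /= -!scalerAl !scalerA.
  by rewrite -[ι v * M1 * P1]mulrA.
have [v1 Δh a1 b1] := skew_pair_relations Hι HC P1ι M1ι gyp gym gv ΔP1 ΔM1 Ed
  (winding_grouplike wp gym) (winding_grouplike wm gyp).
exists d; split=> //; first by rewrite Ed v1 rmorph1 mul1r.
(* Triviality of the commutator [v] is commutation of [rp] and [rm]. *)
have := congr1 (fun x => x * (rm * rp)) v1; rewrite mul1r => <-.
by rewrite /v -!mulrA (mulrA (S rm)) Vrm mul1r Vrp mulr1.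
Qed.

(** The composite is winding, and it preserves the counit because the conjugating factors cancel in
    the field; [winding_counit_id] concludes. *)
Lemma normalized_automorphismK : cancel θp θm.
Proof.
move=> a; apply: (winding_counit_id (winding_comp wm wp)) => {}a.
have ε1 x y : x * y = 1 -> ε x * ε y = 1.
  by rewrite -rmorphM => ->; rewrite rmorph1.
rewrite /= θmE θpE !asigmaV_mul asigmaK !rmorphM /=.
have τ1 : ε (τ (S rm)) * ε (τ rm) = 1.
  by rewrite ε1 // -asigmaV_mul Vrm asigmaV1.
by rewrite mulrAC τ1 mul1r mulrAC ε1 // mul1r.
Qed.

(** The left inverse is two-sided because [θp] is surjective. *)
Lemma normalized_automorphismVK : cancel θm θp.
Proof.
have surj x : θp (rp * τ x * S rp) = x.
  by rewrite θpE !mulrA Vrp mul1r -mulrA Vrp mulr1 asigmaVK.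
by move=> x; rewrite -(surj x) normalized_automorphismK.
Qed.

Lemma normalized_choice : exists (χ : {lrmorphism R -> k^o}) (c : k),
  [/\ hopf_ambiskew_choice HR χ (yp * ym) yp ym h1, θp =1 tau_l HR χ,
      χ yp = c, c != 0 & P1 * M1 = ι h1 + c *: (M1 * P1) /\ rp * rm = rm * rp].
Proof.
have [c [PM rpm Δh a b]] := normalized_relations.
have θK := normalized_automorphismK; have θVK := normalized_automorphismVK.
pose χ : {lrmorphism R -> k^o} := counit HR \o θp.
have c0 : c != 0.
  apply/eqP => c0; move: b; rewrite c0 mul0r => /eqP.
  by rewrite eq_sym oner_eq0.
(* With p and q the scalars by which [θp] and [θm] act on [yp], the composite being the identity
   gives p q = 1, and c q = 1 is already known. *)
have χp : χ yp = c.
  have εy := grouplike_counit gyp.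
  have /(congr1 ε) := θK yp; rewrite (winding_grouplike wp gyp).
  set p := ε (θp yp); rewrite linearZ /= (winding_grouplike wm gyp).
  set q := ε (θm yp) in b *; rewrite !linearZ /= εy.
  rewrite [q *: _]mulr1 => pq; rewrite -[LHS]mulr1 -b mulrCA.
  by rewrite [X in _ * X]pq mulr1.
have gz := grouplikeM gyp gym; have cz := central_mul cyp cym.
(* Both P1 M1 and M1 P1 commute with [R], since [θp] and [θm] are mutually inverse; hence so does
   [h1]. *)
have ch : central h1.
  move=> x; apply: (@iota_R_inj _ _ D); rewrite !rmorphM.
  have PMx : P1 * M1 * ι x = ι x * (P1 * M1).
    rewrite -[P1 * M1 * ι x]mulrA M1ι (mulrA P1 (ι _)) P1ι θVK.
    by rewrite -[ι x * P1 * M1]mulrA.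
  have MPx : M1 * P1 * ι x = ι x * (M1 * P1).
    rewrite -[M1 * P1 * ι x]mulrA P1ι (mulrA M1 (ι _)) M1ι θK.
    by rewrite -[ι x * M1 * P1]mulrA.
  move: PMx; rewrite PM mulrDl mulrDr -scalerAl -scalerAr MPx => /addIr.
  by rewrite !rmorphM.
exists χ, c; split=> //.
- split=> //; first by split=> //; rewrite χp -a.
  exact: cocommutative_skew_primitive.
- by move=> x; apply: winding_counit.
Qed.

(** The new data [D'] receives its Hopf structure from the first half, [f] comes from the universal
    property of [D'], and its inverse [g] from that of [D]. *)
Lemma ambiskew_hopf_converse :
  exists (χ : {lrmorphism R -> k^o}) (z yp ym h : R) (D' : ambiskew_data R)
    (HA' : hopf (ambiskew D')) (f : {lrmorphism ambiskew D' -> ambiskew D}),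
  [/\ hopf_ambiskew_choice HR χ z yp ym h,
      hopf_ambiskew HR χ yp ym h HA',
      hopf_morphism HA' HA f /\ bijective f,
      forall r : R, f (iota_R D' r) = ι r
    & f (Xplus D') = P1 /\ f (Xminus D') = M1].
Proof.
have [χ [c [choice θτ χc c0 [PM rpm]]]] := normalized_choice.
have [_ _ _ ch _] := choice.
pose D' :=
  AmbiskewData normalized_automorphismK normalized_automorphismVK ch c0.
have [HA' HA'P] := hopf_ambiskew_of_data Hc choice (D := D') θτ erefl (esym χc).
have [_ Hι' ΔP' ΔM'] := HA'P.
have [f [fι fP fM]] := @ambiskew_lrmorphism _ _ D' A ι P1 M1 P1ι M1ι PM.
have [_ ει _] := Hι; have [Δι' ει' _] := Hι'; have [Δι _ _] := Hι.
have ι1 := rmorph1 (iota_R D').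
have εP := Xplus_counit Hι ΔP; have εM := Xminus_counit Hι ΔM.
have εP' : counit HA' (Xplus D') = 0.
  by apply: (Xplus_counit Hι' (l := yp) (r := 1)); rewrite ι1.
have εM' : counit HA' (Xminus D') = 0.
  by apply: (Xminus_counit Hι' (l := ym) (r := 1)); rewrite ι1.
have fH : hopf_morphism HA' HA f.
  apply: ambiskew_hopf_morphism => [r||].
  - split; last by rewrite fι ει -ει'.
    rewrite fι Δι Δι' tmap_tmap; try lin.
    by apply: eq_tsum => x y; rewrite !fι.
  - split; last by rewrite fP rmorphM /= εP mul0r εP'.
    rewrite fP ΔP1 ΔP' tmapD; try lin.
    by rewrite !tmapE ?fP ?fι ?rmorph1 //; lin.
  - split; last by rewrite fM rmorphM /= εM mul0r εM'.
    rewrite fM ΔM1 ΔM' tmapD; try lin.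
    by rewrite !tmapE ?fM ?fι ?rmorph1 //; lin.
(* The old variables are recovered by multiplying the new ones by [rp] and [rm]; the defining
   relations of [D] must be checked for them. *)
have [g [gι gP gM]] : exists g : {lrmorphism A -> ambiskew D'},
    [/\ forall r, g (ι r) = iota_R D' r, g P = Xplus D' * iota_R D' rp
      & g M = Xminus D' * iota_R D' rm].
  have [α Eσ] : exists α : k, σ rp = α *: rp.
    exists (ε (θp rp)); rewrite -(winding_grouplike wp gp) θpE.
    by rewrite Vrp mul1r.
  have [β Eτ] : exists β : k, τ rm = β *: rm.
    exists (ε (θm rm)); rewrite -(winding_grouplike wm gm) θmE.
    by rewrite Vrm mul1r.
  have σrm : rm * σ rp = σ rp * rm by rewrite Eσ -scalerAl -scalerAr rpm.
  have τrp : rp * τ rm = τ rm * rp by rewrite Eτ -scalerAl -scalerAr rpm.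
  (* Two expressions for P1 M1 are known; their coordinates along M1 P1 identify [c] with [axi D]
     times the factor [e], and the unit [rm * σ rp] clears the antipodes. *)
  have e_c : axi D *: (τ rm * rp) = c *: (σ rp * rm).
    have [C [Cl HC]] := normalized_coordinates.
    have CZ a x : C 1%N 1%N (a *: x) = a *: C 1%N 1%N x.
      exact: (GRing.scalable_linear (Cl 1%N 1%N)).
    have CMP x : C 1%N 1%N (ι x * (M1 * P1)) = x by case: (HC 1%N 1%N x).
    have CMP1 : C 1%N 1%N (M1 * P1) = 1.
      by rewrite -[X in C _ _ X]mul1r -(rmorph1 ι) CMP.
    have := normalized_pair_relation; rewrite PM => /addrI.
    rewrite -[M1 * P1 * ι _]mulrA P1ι (mulrA M1 (ι _)) M1ι.
    rewrite normalized_automorphismK -[_ * M1 * P1]mulrA => /(congr1 (C 1 1)%N).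
    rewrite !CZ CMP CMP1 => /(congr1 (fun x => x * (rm * σ rp))) /=.
    rewrite -!scalerAl mul1r -[rp * τ rm * _ * _]mulrA.
    have -> : σ (S rp) * S rm * (rm * σ rp) = 1.
      by rewrite -mulrA (mulrA (S rm)) Vrm mul1r -rmorphM Vrp rmorph1.
    by rewrite mulr1 σrm τrp.
  pose P' := Xplus D'; pose M' := Xminus D'; pose ι' := iota_R D'.
  have ι'M x y : ι' x * ι' y = ι' (x * y) by rewrite /ι' rmorphM.
  have P'ι x : P' * ι' x = ι' (θp x) * P' := Xplus_iota D' x.
  have M'ι x : M' * ι' x = ι' (θm x) * M' := Xminus_iota D' x.
  have ιP' x : ι' x * P' = P' * ι' (θm x) := iota_Xplus D' x.
  have ιM' x : ι' x * M' = M' * ι' (θp x) := iota_Xminus D' x.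
  have P'M' : P' * M' = ι' h1 + c *: (M' * P') := Xplus_Xminus D'.
  have hp x : P' * ι' rp * ι' x = ι' (σ x) * (P' * ι' rp).
    rewrite -mulrA ι'M !P'ι mulrA ι'M !θpE !mulrA Vrp !mul1r.
    by rewrite rmorphM.
  have hm x : M' * ι' rm * ι' x = ι' (τ x) * (M' * ι' rm).
    rewrite -mulrA ι'M !M'ι mulrA ι'M !θmE !mulrA Vrm !mul1r.
    by rewrite asigmaV_mul.
  have hpm : P' * ι' rp * (M' * ι' rm) =
      ι' (ah D) + axi D *: (M' * ι' rm * (P' * ι' rp)).
    have -> : P' * ι' rp * (M' * ι' rm) = P' * M' * ι' (σ rp * rm).
      by rewrite -!mulrA (mulrA (ι' rp)) ιM' -!mulrA ι'M θpE Vrp mul1r.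
    have -> : M' * ι' rm * (P' * ι' rp) = M' * P' * ι' (τ rm * rp).
      by rewrite -!mulrA (mulrA (ι' rm)) ιP' -!mulrA ι'M θmE Vrm mul1r.
    have ι'Z a x : ι' (a *: x) = a *: ι' x by rewrite /ι' linearZ.
    rewrite P'M' mulrDl -scalerAl scalerAr -ι'Z -e_c ι'Z -scalerAr ι'M.
    congr (ι' _ + _); rewrite -!mulrA -[X in _ * (_ * (_ * X))]σrm.
    by rewrite (mulrA (S rm)) Vrm mul1r -rmorphM Vrp rmorph1 mulr1.
  exact: (@ambiskew_lrmorphism _ _ D _ ι' _ _ hp hm hpm).
have fK : cancel f g.
  move=> x; elim/ambiskew_gen_ind: x => [r|||x y hx hy|x y hx hy].
  - by rewrite fι gι.
  - by rewrite fP rmorphM /= gP gι -mulrA -rmorphM rpV rmorph1 mulr1.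
  - by rewrite fM rmorphM /= gM gι -mulrA -rmorphM rmV rmorph1 mulr1.
  - by rewrite !rmorphD /= hx hy.
  - by rewrite !rmorphM /= hx hy.
have gK : cancel g f.
  move=> x; elim/ambiskew_gen_ind: x => [r|||x y hx hy|x y hx hy].
  - by rewrite gι fι.
  - by rewrite gP rmorphM /= fP fι -mulrA -rmorphM Vrp rmorph1 mulr1.
  - by rewrite gM rmorphM /= fM fι -mulrA -rmorphM Vrm rmorph1 mulr1.
  - by rewrite !rmorphD /= hx hy.
  - by rewrite !rmorphM /= hx hy.
exists χ, (yp * ym), yp, ym, h1, D', HA', f; split=> //.
by split=> //; exists g.
Qed.

End Converse.

Theorem proposition3p3 (k : fieldType) (R : algType k) (HR : hopf R)
    (Rcocomm : cocommutative HR) :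
  (forall (chi : {lrmorphism R -> k^o}) (z yp ym h : R),
     hopf_ambiskew_choice HR chi z yp ym h ->
     (primitive HR h /\ z = 1 ->
        two_sided_inverse yp ym /\ (chi yp = 1 \/ chi yp = -1)) /\
     exists (D : ambiskew_data R) (HA : hopf (ambiskew D)),
       hopf_ambiskew HR chi yp ym h HA)
  /\
  (forall (D : ambiskew_data R) (HA : hopf (ambiskew D)) (lp rp lm rm : R),
     hopf_morphism HR HA (iota_R D) ->
     comul HA (Xplus D) =
       tens (Xplus D) (iota_R D rp) + tens (iota_R D lp) (Xplus D) ->
     comul HA (Xminus D) =
       tens (Xminus D) (iota_R D rm) + tens (iota_R D lm) (Xminus D) ->
     exists rpV rmV : R,
       [/\ two_sided_inverse rp rpV, two_sided_inverse rm rmV &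
        exists (chi : {lrmorphism R -> k^o}) (z yp ym h : R)
               (D' : ambiskew_data R) (HA' : hopf (ambiskew D'))
               (f : {lrmorphism ambiskew D' -> ambiskew D}),
          [/\ hopf_ambiskew_choice HR chi z yp ym h,
              hopf_ambiskew HR chi yp ym h HA',
              hopf_morphism HA' HA f /\ bijective f,
              forall r : R, f (iota_R D' r) = iota_R D r
            & f (Xplus D') = Xplus D * iota_R D rpV /\
              f (Xminus D') = Xminus D * iota_R D rmV]]).
Proof.
split=> [χ z yp ym h choice|D HA lp rp lm rm Hι ΔP ΔM].
  have [[_ gyp _] [_ cyp cym] [zE χE] ch _] := choice.
  split=> [[_ z1]|].
    have yy : yp * ym = 1 by rewrite -zE.
    split; first by split=> //; rewrite cym.
    (* As χ(yp) = χ(ym), the square is χ(yp ym) = χ(1) = 1. *)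
    have : (χ yp : k) ^+ 2 == 1 ^+ 2.
      by rewrite expr1n expr2 {2}χE -[_ * _]rmorphM yy rmorph1.
    by rewrite eqf_sqr => /orP[] /eqP; [left | right].
  have [D [σE hE ξE]] := winding_ambiskew_data Rcocomm χ ch
    (character_grouplike_neq0 χ gyp).
  exists D; exact: (hopf_ambiskew_of_data Rcocomm choice σE hE ξE).
have [θp [[gp θpE] P1ι ΔP1 wp [gyp cyp]]] := normalize_Xplus Rcocomm Hι ΔP.
have [θm [[gm θmE] M1ι ΔM1 wm [gym cym]]] := normalize_Xminus Rcocomm Hι ΔM.
exists (antipode HR rp), (antipode HR rm); split.
- by split; [apply: grouplike_mulrV | apply: grouplike_mulVr].
- by split; [apply: grouplike_mulrV | apply: grouplike_mulVr].
exact: (ambiskew_hopf_converse Rcocomm Hι ΔP ΔM gp gm θpE θmE P1ι M1ι ΔP1 ΔM1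
  wp wm gyp gym cyp cym).
Qed.
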